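(* There exist universal constants $C_1, C_2\in \mathbb{R}$ such that, for every non-elliptic semigroup $(\phi_t)$ in $\mathbb{D}$, with total speed $v(t)$ and orthogonal speed $v^o(t)$, $$v^o(t)+C_1\leq v(t)\leq 2v^o(t)+C_2$$ for all $t\geq 0$.
   Context: Let $\mathbb{D}=\{\zeta\in\mathbb{C}:|\zeta|<1\}$ with hyperbolic distance $\omega(z,w)=\frac12\log\frac{1+|T_z(w)|}{1-|T_z(w)|}$, $T_z(w)=\frac{z-w}{1-\overline{z}w}$. A non-elliptic semigroup in $\mathbb{D}$ is a family $(\phi_t)_{t\ge0}$ of holomorphic maps $\phi_t:\mathbb{D}\to\mathbb{D}$ such that $\phi_0=\mathrm{id}$, $\phi_{t+s}=\phi_t\circ\phi_s$ for all $s,t\ge0$, $t\mapsto\phi_t$ is continuous for the topology of uniform convergence on compacta of $\mathbb{D}$, and $\phi_t$ has no fixed point in $\mathbb{D}$ for $t>0$. Its Denjoy-Wolff point is the unique $\tau\in\partial\mathbb{D}$ such that $\lim_{t\to\infty}\phi_t(z)=\tau$ for all $z\in\mathbb{D}$. Let $\gamma:(-1,1)\to\mathbb{D}$, $\gamma(r)=r\tau$ (a geodesic), and for $z\in\mathbb{D}$ let $\pi_\gamma(z)$ be the unique point of $\gamma((-1,1))$ closest to $z$ with respect to $\omega$. The total speed is $v(t):=\omega(0,\phi_t(0))$ and the orthogonal speed is $v^o(t):=\omega(0,\pi_\gamma(\phi_t(0)))$, $t\ge0$. *)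

(* Defs.v *)
From Stdlib Require Import Reals List.
From Coquelicot Require Import Coquelicot.
Open Scope R_scope.

Definition disc (z : C) : Prop := Cmod z < 1.

Definition Tmap (z w : C) : C := ((z - w) / (1 - Cconj z * w))%C.

Definition omega (z w : C) : R :=
  / 2 * ln ((1 + Cmod (Tmap z w)) / (1 - Cmod (Tmap z w))).

Definition compact_set (K : C -> Prop) : Prop :=
  forall F : (C -> Prop) -> Prop,
    (forall U, F U -> open U) ->
    (forall z, K z -> exists U, F U /\ U z) ->
    exists l : list (C -> Prop),
      (forall U, In U l -> F U) /\
      (forall z, K z -> exists U, In U l /\ U z).

(** A self-map of the disc is represented by a total function [C -> C] of which
    only the values on [disc] matter. As [disc] is open, the complex
    differentiability [ex_derive f z] at a point [z] of [disc] does not depend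
    on the values of [f] outside [disc]. *)
Definition holomorphic_self_map (f : C -> C) : Prop :=
  (forall z, disc z -> disc (f z)) /\
  (forall z, disc z -> ex_derive (K := C_AbsRing) (V := C_NormedModule) f z).

(** Only the values [phi t z] with [0 <= t] and [disc z] matter. *)
Record nonelliptic_semigroup (phi : R -> C -> C) : Prop := {
  sg_holomorphic : forall t, 0 <= t -> holomorphic_self_map (phi t);
  sg_id : forall z, disc z -> phi 0 z = z;
  sg_comp : forall t s, 0 <= t -> 0 <= s ->
    forall z, disc z -> phi (t + s) z = phi t (phi s z);
  (* continuity on [0, +oo) for uniform convergence on compacta of the disc *)
  sg_continuous : forall t0, 0 <= t0 ->
    forall K : C -> Prop, compact_set K -> (forall z, K z -> disc z) ->
    forall eps, 0 < eps -> exists delta, 0 < delta /\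
      forall t, 0 <= t -> Rabs (t - t0) < delta ->
      forall z, K z -> Cmod (phi t z - phi t0 z)%C < eps;
  sg_no_fixpoint : forall t, 0 < t -> forall z, disc z -> phi t z <> z
}.

Definition Denjoy_Wolff_point (phi : R -> C -> C) (tau : C) : Prop :=
  Cmod tau = 1 /\
  forall z, disc z ->
    filterlim (fun t => phi t z) (Rbar_locally p_infty) (locally tau).

Definition geodesic (tau : C) (r : R) : C := (RtoC r * tau)%C.

Definition closest_on_geodesic (tau z p : C) : Prop :=
  (exists r, -1 < r < 1 /\ p = geodesic tau r) /\
  (forall r, -1 < r < 1 -> omega z p <= omega z (geodesic tau r)).

(** [iota P] is the unique point satisfying [P] when there is exactly one
    ([iota_correct]), as is the case here for [Cmod tau = 1] and [disc z]. *)
Definition proj_geodesic (tau z : C) : C :=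
  iota (T := C_CompleteNormedModule) (closest_on_geodesic tau z).

Definition total_speed (phi : R -> C -> C) (t : R) : R :=
  omega 0 (phi t 0).

Definition orthogonal_speed (phi : R -> C -> C) (tau : C) (t : R) : R :=
  omega 0 (proj_geodesic tau (phi t 0)).

(* Main.v *)
From Stdlib Require Import Reals Lra Lia ClassicalEpsilon.
From Coquelicot Require Import Coquelicot.
(* Last, so that [disc] is the unit disc and not the real disc of [Reals]. *)
Require Import Defs.
Open Scope R_scope.

(** The orbit [z = phi t 0] stays in the closed horodisc of centre [tau] through [0]
    (Julia's inequality): [|tau - z|^2 <= 1 - |z|^2]. Put [x = |z|] and
    [a = Re (conj tau * z)]. The point of the diameter closest to [z] is
    [r * tau], where [r] is the root in [(-1, 1)] of
    [a (1 + r^2) = (1 + x^2) r]; so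
    [((1 + |r|) / (1 - |r|))^2 = (1 + x^2 + 2|a|) / (1 + x^2 - 2|a|)].
    As [|a| <= x], one has [|r| <= x], whence [v^o <= v]. Julia's inequality
    says that [x^2 <= a], so the quotient is at least
    [(1 + 3 x^2) / (1 - x^2)], which is at least half of [(1 + x) / (1 - x)];
    taking logarithms, [v <= 2 v^o + (ln 2) / 2].

    Julia's inequality is obtained from Harnack's inequality ([Harnack]) for
    the Cayley transform [(sigma + f) / (sigma - f)] of a self-map [f] of the
    disc, whose real part is [(1 - |f|^2) / |sigma - f|^2]. Apply it to
    [f = phi t] at the iterate [z_n = phi (n t) 0], with [sigma] the radial
    projection of [z_(n+1)] on the unit circle: when [|z_n| <= |z_(n+1)|],
    which holds for infinitely many [n] as [|z_n|] tends to [1], it gives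
    [|sigma - z|^2 <= 1 - |z|^2], and [sigma] tends to [tau].

    Harnack's inequality follows by integration along a radius from the
    derivative bound [Re (H' 0) <= 2 Re (H 0)] for [H] holomorphic with
    nonnegative real part ([half_plane_derivative_bound]), transported to the
    other points by disc automorphisms. For that bound, the mean over the circle
    of radius [s] of [H (z) (2 - z / rho - rho / z)] does not depend on [s]; it
    tends to [2 H 0 - rho H' 0] as [s] tends to [0], and at [s = rho] its real
    part is the mean of [(2 - 2 cos) Re H >= 0]. That circular means of
    a holomorphic function on a punctured disc are constant is Goursat's theorem
    ([Goursat]) on a rectangle in the variable [log z]. *)

(** * Complex differentiability *)

(** [F] has complex derivative [l] at [p]. The codomain is [C] as a normed module
    over itself, for which the product and chain rules are available. *)
Definition Cder (F : C -> C) (p l : C) : Prop :=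
  is_derive (K := C_AbsRing) (V := AbsRing_NormedModule C_AbsRing) F p l.

Lemma is_derive_Cder (F : C -> C) (p l : C) :
  is_derive (K := C_AbsRing) (V := C_NormedModule) F p l -> Cder F p l.
Proof.
intros [_ H]; split.
- apply is_linear_scal_l.
- exact H.
Qed.

(** The definition of the derivative by first-order estimates. *)
Lemma Cder_eps (F : C -> C) (p l : C) : Cder F p l <->
  forall eps, 0 < eps -> exists d, 0 < d /\ forall q, Cmod (q - p) < d ->
    Cmod (F q - F p - l * (q - p)) <= eps * Cmod (q - p).
Proof.
split.
- intros [_ H] eps Heps.
  destruct (H p (fun P HP => HP) (mkposreal eps Heps)) as [d Hd].
  exists d; split; [apply cond_pos|].
  intros q Hq; specialize (Hd q Hq).
  replace (F q - F p - l * (q - p))%C with (F q - F p - (q - p) * l)%C by ring.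
  exact Hd.
- intros H; split; [apply is_linear_scal_l|].
  intros x Hx eps.
  assert (x = p) as ->.
  { symmetry; apply (is_filter_lim_locally_unique (K := C_AbsRing) (V := AbsRing_NormedModule C_AbsRing)). exact Hx. }
  destruct (H eps (cond_pos eps)) as [d [Hd0 Hd]].
  exists (mkposreal d Hd0); intros q Hq; specialize (Hd q Hq).
  replace (F q - F p - l * (q - p))%C with (F q - F p - (q - p) * l)%C in Hd by ring.
  exact Hd.
Qed.

Lemma Cder_const (c p : C) : Cder (fun _ => c) p 0.
Proof. apply (is_derive_const (K := C_AbsRing) (V := AbsRing_NormedModule C_AbsRing)). Qed.

Lemma Cder_id (p : C) : Cder (fun z => z) p 1.
Proof. apply (is_derive_id (K := C_AbsRing)). Qed.

Lemma Cder_plus (F G : C -> C) (p l m : C) :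
  Cder F p l -> Cder G p m -> Cder (fun z => F z + G z)%C p (l + m)%C.
Proof. apply (is_derive_plus (K := C_AbsRing) (V := AbsRing_NormedModule C_AbsRing)). Qed.

Lemma Cder_minus (F G : C -> C) (p l m : C) :
  Cder F p l -> Cder G p m -> Cder (fun z => F z - G z)%C p (l - m)%C.
Proof. apply (is_derive_minus (K := C_AbsRing) (V := AbsRing_NormedModule C_AbsRing)). Qed.

Lemma Cder_mult (F G : C -> C) (p l m : C) :
  Cder F p l -> Cder G p m -> Cder (fun z => F z * G z)%C p (l * G p + F p * m)%C.
Proof.
intros HF HG; apply (is_derive_mult (K := C_AbsRing)); [exact HF|exact HG|].
apply Cmult_comm.
Qed.

Lemma Cder_comp (F G : C -> C) (p l m : C) :
  Cder F (G p) l -> Cder G p m -> Cder (fun z => F (G z)) p (m * l)%C.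
Proof. apply (is_derive_comp (K := C_AbsRing) (V := AbsRing_NormedModule C_AbsRing)). Qed.

Lemma Cder_inv (p : C) : p <> 0 -> Cder Cinv p (- / (p * p))%C.
Proof.
intros Hp; apply Cder_eps; intros eps Heps.
assert (Hp' : 0 < Cmod p) by now apply Cmod_gt_0.
assert (H3 : 0 < Cmod p * Cmod p * Cmod p) by (repeat apply Rmult_lt_0_compat; lra).
exists (Rmin (Cmod p / 2) (eps * (Cmod p * Cmod p * Cmod p) / 2)); split.
{ apply Rmin_pos; [lra|]. apply Rdiv_lt_0_compat; [|lra]. now apply Rmult_lt_0_compat. }
intros q Hq.
assert (H1 := Rlt_le_trans _ _ _ Hq (Rmin_l _ _)).
assert (H2 := Rlt_le_trans _ _ _ Hq (Rmin_r _ _)).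
assert (Hqm : Cmod p / 2 <= Cmod q).
{ assert (H := Cmod_triangle q (- (q - p))).
  replace (q + - (q - p))%C with p in H by ring.
  rewrite Cmod_opp in H; lra. }
assert (Hq0 : q <> 0) by (apply Cmod_gt_0; lra).
replace (/ q - / p - - / (p * p) * (q - p))%C
  with ((q - p) * (q - p) * / (p * p * q))%C by (field; auto).
rewrite !Cmod_mult, Cmod_inv by (repeat apply Cmult_neq_0; auto).
rewrite !Cmod_mult, (Rmult_comm eps), Rmult_assoc.
apply Rmult_le_compat_l; [apply Cmod_ge_0|].
assert (Hpp : 0 < Cmod p * Cmod p) by now apply Rmult_lt_0_compat.
apply Rmult_le_reg_r with (Cmod p * Cmod p * Cmod q); [apply Rmult_lt_0_compat; lra|].
rewrite Rmult_assoc, Rinv_l, Rmult_1_r by (apply Rgt_not_eq, Rmult_lt_0_compat; lra).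
apply Rle_trans with (eps * (Cmod p * Cmod p * (Cmod p / 2))); [lra|].
apply Rmult_le_compat_l; [lra|]. apply Rmult_le_compat_l; lra.
Qed.

Lemma Cder_div (F G : C -> C) (p l m : C) :
  G p <> 0 -> Cder F p l -> Cder G p m ->
  Cder (fun z => F z / G z)%C p ((l * G p - F p * m) / (G p * G p))%C.
Proof.
intros H0 HF HG.
replace ((l * G p - F p * m) / (G p * G p))%C
  with (l * / G p + F p * (m * - / (G p * G p)))%C by (field; auto).
apply (Cder_mult F (fun z => / G z)%C); [exact HF|].
apply (Cder_comp Cinv G p (- / (G p * G p))%C m); [now apply Cder_inv|exact HG].
Qed.

(** The real derivative as a first-order estimate. *)
Lemma deriv_eps (f : R -> R) (x l : R) : is_derive f x l ->
  forall eps, 0 < eps -> exists d, 0 < d /\ forall h, Rabs h < d ->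
    Rabs (f (x + h) - f x - l * h) <= eps * Rabs h.
Proof.
intros [_ H] eps Heps.
destruct (H x (fun P HP => HP) (mkposreal eps Heps)) as [d Hd].
exists d; split; [apply cond_pos|].
intros h Hh.
assert (B : ball x d (x + h)).
{ change (Rabs (x + h - x) < d). now replace (x + h - x) with h by ring. }
specialize (Hd _ B).
change (Rabs (f (x + h) - f x - (x + h - x) * l) <= eps * Rabs (x + h - x)) in Hd.
replace (x + h - x) with h in Hd by ring.
now replace (l * h) with (h * l) by ring.
Qed.

(** The complex exponential. *)
Definition Cexp (w : C) : C := (exp (Re w) * cos (Im w), exp (Re w) * sin (Im w)).

Lemma Cexp_plus (v w : C) : Cexp (v + w) = (Cexp v * Cexp w)%C.
Proof.
unfold Cexp; rewrite re_plus, im_plus, exp_plus, cos_plus, sin_plus.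
unfold Cmult; simpl; f_equal; ring.
Qed.

Lemma Cmod_Cexp (w : C) : Cmod (Cexp w) = exp (Re w).
Proof.
unfold Cmod, Cexp; simpl fst; simpl snd.
replace ((exp (Re w) * cos (Im w)) ^ 2 + (exp (Re w) * sin (Im w)) ^ 2)
  with (exp (Re w) ^ 2 * ((sin (Im w))² + (cos (Im w))²)) by (unfold Rsqr; ring).
rewrite sin2_cos2, Rmult_1_r.
apply sqrt_pow2, Rlt_le, exp_pos.
Qed.

Lemma Cmod_le_abs (w : C) : Cmod w <= Rabs (Re w) + Rabs (Im w).
Proof.
replace w with ((RtoC (Re w) + RtoC (Im w) * Ci)%C) at 1
  by (unfold Re, Im; destruct w; apply injective_projections; simpl; ring).
eapply Rle_trans; [apply Cmod_triangle|].
rewrite Cmod_mult, Cmod_Ci, !Cmod_R; lra.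
Qed.

Lemma im_le_Cmod (w : C) : Rabs (Im w) <= Cmod w.
Proof. eapply Rle_trans; [apply Rmax_r|apply Rmax_Cmod]. Qed.

Lemma Cder_Cexp_0 : Cder Cexp 0 1.
Proof.
apply Cder_eps; intros eps Heps.
set (e := Rmin 1 (eps / 10)).
assert (He : 0 < e) by (apply Rmin_pos; lra).
assert (He1 : e <= 1) by apply Rmin_l.
assert (He2 : e <= eps / 10) by apply Rmin_r.
assert (De : is_derive exp 0 1) by (rewrite <- exp_0; apply is_derive_exp).
assert (Dc : is_derive cos 0 0).
{ replace 0 with (- sin 0) at 2 by (rewrite sin_0; ring). apply is_derive_cos. }
assert (Ds : is_derive sin 0 1) by (rewrite <- cos_0; apply is_derive_sin).
destruct (deriv_eps _ _ _ De e He) as [d1 [Hd1 H1]].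
destruct (deriv_eps _ _ _ Dc e He) as [d2 [Hd2 H2]].
destruct (deriv_eps _ _ _ Ds e He) as [d3 [Hd3 H3]].
exists (Rmin (Rmin d1 e) (Rmin d2 d3)); split; [apply Rmin_pos; now apply Rmin_pos|].
intros q; replace (q - 0)%C with q by ring; intros Hq.
assert (Hx := re_le_Cmod q); assert (Hy := im_le_Cmod q).
destruct (Rmin_Rgt_l _ _ _ Hq) as [Hq1 Hq2].
apply Rmin_Rgt_l in Hq1; apply Rmin_Rgt_l in Hq2.
specialize (H1 (Re q) ltac:(lra)).
specialize (H2 (Im q) ltac:(lra)).
specialize (H3 (Im q) ltac:(lra)).
rewrite Rplus_0_l, exp_0 in H1.
rewrite Rplus_0_l, cos_0 in H2.
rewrite Rplus_0_l, sin_0 in H3.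
assert (Hc : Cmod q <= e) by lra.
assert (Ax := Rabs_pos (Re q)); assert (Ay := Rabs_pos (Im q)).
set (x := Re q) in *; set (y := Im q) in *.
assert (Hex : Rabs (exp x - 1) <= 2 * Rabs x).
{ replace (exp x - 1) with ((exp x - 1 - 1 * x) + x) by ring.
  eapply Rle_trans; [apply Rabs_triang|]. nra. }
assert (Hex3 : Rabs (exp x) <= 3).
{ replace (exp x) with ((exp x - 1) + 1) by ring.
  eapply Rle_trans; [apply Rabs_triang|]. rewrite Rabs_R1. lra. }
assert (HR : Rabs (exp x * cos y - 1 - x) <= 4 * e * Cmod q).
{ replace (exp x * cos y - 1 - x)
    with ((exp x - 1 - 1 * x) + exp x * (cos y - 1 - 0 * y)) by ring.
  eapply Rle_trans; [apply Rabs_triang|]. rewrite Rabs_mult.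
  assert (P := Rmult_le_compat _ _ _ _ (Rabs_pos _) (Rabs_pos _) Hex3 H2). nra. }
assert (HI : Rabs (exp x * sin y - y) <= 5 * e * Cmod q).
{ replace (exp x * sin y - y)
    with (exp x * (sin y - 0 - 1 * y) + (exp x - 1) * y) by ring.
  eapply Rle_trans; [apply Rabs_triang|]. rewrite !Rabs_mult.
  assert (P := Rmult_le_compat _ _ _ _ (Rabs_pos _) (Rabs_pos _) Hex3 H3).
  assert (P2 := Rmult_le_compat_r _ _ _ Ay Hex). nra. }
eapply Rle_trans; [apply Cmod_le_abs|].
replace (Re (Cexp q - Cexp 0 - 1 * q)) with (exp x * cos y - 1 - x)
  by (unfold Cexp, x, y; simpl; rewrite exp_0, cos_0; unfold Re, Im; ring).
replace (Im (Cexp q - Cexp 0 - 1 * q)) with (exp x * sin y - y)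
  by (unfold Cexp, x, y; simpl; rewrite exp_0, sin_0; unfold Re, Im; ring).
assert (0 <= Cmod q) by apply Cmod_ge_0.
nra.
Qed.

Lemma Cder_Cexp (w : C) : Cder Cexp w (Cexp w).
Proof.
assert (H : Cder (fun z => Cexp w * Cexp (z - w))%C w (Cexp w)).
{ assert (E : (0 * Cexp (w - w) + Cexp w * ((1 - 0) * 1))%C = Cexp w) by ring.
  refine (eq_ind _ (Cder _ w) _ _ E).
  apply (Cder_mult (fun _ => Cexp w) (fun z => Cexp (z - w)%C) w 0 ((1 - 0) * 1)%C); [apply Cder_const|].
  apply (Cder_comp Cexp (fun z => z - w)%C w 1 (1 - 0)%C).
  - replace (w - w)%C with (RtoC 0) by ring. apply Cder_Cexp_0.
  - apply Cder_minus; [apply Cder_id|apply Cder_const]. }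
revert H; apply (is_derive_ext (K := C_AbsRing) (V := AbsRing_NormedModule C_AbsRing)).
intros z; rewrite <- Cexp_plus. f_equal. change (w + (z - w) = z)%C. ring.
Qed.

Lemma Cder_lipschitz (F : C -> C) (p l : C) : Cder F p l ->
  exists M d, 0 < M /\ 0 < d /\
    forall q, Cmod (q - p) < d -> Cmod (F q - F p) <= M * Cmod (q - p).
Proof.
intros H; destruct (proj1 (Cder_eps _ _ _) H 1 Rlt_0_1) as [d [Hd Hq]].
exists (1 + Cmod l), d; split; [assert (A := Cmod_ge_0 l); lra|split; [assumption|]].
intros q Hqd; specialize (Hq q Hqd).
replace (F q - F p)%C with (F q - F p - l * (q - p) + l * (q - p))%C by ring.
eapply Rle_trans; [apply Cmod_triangle|]. rewrite Cmod_mult; lra.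
Qed.

Lemma Cder_continuous (F : C -> C) (p l : C) : Cder F p l ->
  forall eps, 0 < eps -> exists d, 0 < d /\
    forall q, Cmod (q - p) < d -> Cmod (F q - F p) < eps.
Proof.
intros H eps Heps; destruct (Cder_lipschitz _ _ _ H) as [M [d [HM [Hd Hq]]]].
exists (Rmin d (eps / M)); split; [apply Rmin_pos; [assumption|now apply Rdiv_lt_0_compat]|].
intros q Hqd; apply Rmin_Rgt_l in Hqd; destruct Hqd as [H1 H2].
eapply Rle_lt_trans; [apply Hq, H1|].
apply Rmult_gt_compat_l with (r := M) in H2; [|lra].
replace (M * (eps / M)) with eps in H2 by (field; lra). exact H2.
Qed.

(** * Goursat's theorem on a rectangle *)

(** Below, [P] is the real or imaginary part and [L] a horizontal or vertical
    line. *)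
Lemma continuous_along (F : C -> C) (P : C -> R) (L : R -> C) (t0 : R) (l : C) :
  (forall u v, Rabs (P u - P v) <= Cmod (u - v)) ->
  (forall t s, Cmod (L t - L s) <= Rabs (t - s)) ->
  Cder F (L t0) l -> continuous (fun t => P (F (L t))) t0.
Proof.
intros HP HL HF; apply filterlim_locally; intros eps.
destruct (Cder_continuous _ _ _ HF eps (cond_pos eps)) as [d [Hd H]].
exists (mkposreal d Hd); intros t Ht.
change (Rabs (t - t0) < d) in Ht.
change (Rabs (P (F (L t)) - P (F (L t0))) < eps).
eapply Rle_lt_trans; [apply HP|apply H].
eapply Rle_lt_trans; [apply HL|exact Ht].
Qed.

Lemma re_lip (u v : C) : Rabs (Re u - Re v) <= Cmod (u - v).
Proof. apply (re_le_Cmod (u - v)). Qed.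

Lemma im_lip (u v : C) : Rabs (Im u - Im v) <= Cmod (u - v).
Proof. apply (im_le_Cmod (u - v)). Qed.

Lemma horizontal_lip (y t s : R) : Cmod ((t, y) - (s, y))%C <= Rabs (t - s).
Proof.
eapply Rle_trans; [apply Cmod_le_abs|]; simpl.
replace (y + - y) with 0 by ring. rewrite Rabs_R0, Rplus_0_r. apply Rle_refl.
Qed.

Lemma vertical_lip (x t s : R) : Cmod ((x, t) - (x, s))%C <= Rabs (t - s).
Proof.
eapply Rle_trans; [apply Cmod_le_abs|]; simpl.
replace (x + - x) with 0 by ring. rewrite Rabs_R0, Rplus_0_l. apply Rle_refl.
Qed.

(** [F] is complex differentiable at every point of [[a, b] x [c, d]], boundary
    included. *)
Definition holo_on_rect (F : C -> C) (a b c d : R) : Prop :=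
  forall x y, a <= x <= b -> c <= y <= d -> exists l, Cder F (x, y) l.

Lemma ex_RInt_vertical (F : C -> C) (a b c d x : R) :
  holo_on_rect F a b c d -> a <= x <= b -> c <= d ->
  ex_RInt (fun y => Re (F (x, y))) c d.
Proof.
intros HF Hx Hcd; apply (ex_RInt_continuous (V := R_CompleteNormedModule)).
rewrite Rmin_left, Rmax_right by assumption.
intros y Hy; destruct (HF x y Hx Hy) as [l Hl].
apply (continuous_along F Re (fun t => (x, t)) y l); [apply re_lip|apply vertical_lip|exact Hl].
Qed.

Lemma ex_RInt_horizontal (F : C -> C) (a b c d y : R) :
  holo_on_rect F a b c d -> a <= b -> c <= y <= d ->
  ex_RInt (fun x => Im (F (x, y))) a b.
Proof.
intros HF Hab Hy; apply (ex_RInt_continuous (V := R_CompleteNormedModule)).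
rewrite Rmin_left, Rmax_right by assumption.
intros x Hx; destruct (HF x y Hx Hy) as [l Hl].
apply (continuous_along F Im (fun t => (t, y)) x l); [apply im_lip|apply horizontal_lip|exact Hl].
Qed.

Lemma holo_on_subrect (F : C -> C) (a b c d a' b' c' d' : R) :
  holo_on_rect F a b c d -> a <= a' -> b' <= b -> c <= c' -> d' <= d ->
  holo_on_rect F a' b' c' d'.
Proof. intros H H1 H2 H3 H4 x y Hx Hy; apply H; lra. Qed.

(** The imaginary part of the contour integral of [F] along the boundary of
    the rectangle [[a, b] x [c, d]], counterclockwise. *)
Definition flux (F : C -> C) (a b c d : R) : R :=
  (RInt (fun y => Re (F (b, y))) c d - RInt (fun y => Re (F (a, y))) c d) -
  (RInt (fun x => Im (F (x, d))) a b - RInt (fun x => Im (F (x, c))) a b).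

Lemma flux_split_x (F : C -> C) (a m b c d : R) :
  holo_on_rect F a b c d -> a <= m <= b -> c <= d ->
  flux F a b c d = flux F a m c d + flux F m b c d.
Proof.
intros HF Hm Hcd; unfold flux.
assert (E : forall y, c <= y <= d -> RInt (fun x => Im (F (x, y))) a b =
  RInt (fun x => Im (F (x, y))) a m + RInt (fun x => Im (F (x, y))) m b).
{ intros y Hy; symmetry; apply (RInt_Chasles (V := R_CompleteNormedModule)).
  - apply (ex_RInt_horizontal F a m c d); try lra. apply (holo_on_subrect F a b c d); lra || assumption.
  - apply (ex_RInt_horizontal F m b c d); try lra. apply (holo_on_subrect F a b c d); lra || assumption. }
rewrite (E c), (E d) by lra. ring.
Qed.

Lemma flux_split_y (F : C -> C) (a b c m d : R) :
  holo_on_rect F a b c d -> a <= b -> c <= m <= d ->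
  flux F a b c d = flux F a b c m + flux F a b m d.
Proof.
intros HF Hab Hm; unfold flux.
assert (E : forall x, a <= x <= b -> RInt (fun y => Re (F (x, y))) c d =
  RInt (fun y => Re (F (x, y))) c m + RInt (fun y => Re (F (x, y))) m d).
{ intros x Hx; symmetry; apply (RInt_Chasles (V := R_CompleteNormedModule)).
  - apply (ex_RInt_vertical F a b c m); try lra. apply (holo_on_subrect F a b c d); lra || assumption.
  - apply (ex_RInt_vertical F a b m d); try lra. apply (holo_on_subrect F a b c d); lra || assumption. }
rewrite (E a), (E b) by lra. ring.
Qed.

(** An integral of a difference is close to a constant times the length when
    the difference is close to that constant. *)
Lemma RInt_diff_close (f g : R -> R) (a b k e : R) : a <= b ->
  ex_RInt f a b -> ex_RInt g a b ->
  (forall x, a <= x <= b -> Rabs (f x - g x - k) <= e) ->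
  Rabs (RInt f a b - RInt g a b - (b - a) * k) <= (b - a) * e.
Proof.
intros Hab Hf Hg H.
apply (norm_RInt_le_const (V := R_NormedModule) (fun x => f x - g x - k) a b); [assumption|exact H|].
apply (is_RInt_minus (V := R_NormedModule) (fun x => f x - g x) (fun _ => k)).
- apply (is_RInt_minus (V := R_NormedModule) f g); now apply (RInt_correct (V := R_CompleteNormedModule)).
- apply (is_RInt_const (V := R_NormedModule)).
Qed.

(** The affine part of [F] at [p] contributes nothing, by the Cauchy-Riemann
    equations, and the remainder is small with respect to the square of the
    size of the rectangle. *)
Lemma flux_local (F : C -> C) (p l : C) : Cder F p l ->
  forall eps, 0 < eps -> exists delta, 0 < delta /\
  forall a b c d, holo_on_rect F a b c d ->
    a <= Re p <= b -> c <= Im p <= d -> (b - a) + (d - c) < delta ->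
    Rabs (flux F a b c d) <= eps * ((b - a) + (d - c)) ^ 2.
Proof.
intros HF eps Heps.
destruct (proj1 (Cder_eps _ _ _) HF (eps / 2) ltac:(lra)) as [delta [Hd H]].
exists delta; split; [assumption|].
intros a b c d Hol Hx Hy Hs.
set (s := (b - a) + (d - c)) in *.
assert (Hr : forall x y, a <= x <= b -> c <= y <= d ->
  Cmod (F (x, y) - F p - l * ((x, y) - p)) <= eps / 2 * s).
{ intros x y Hx' Hy'.
  assert (Hq : Cmod ((x, y) - p) <= s).
  { eapply Rle_trans; [apply Cmod_le_abs|].
    change (Re ((x, y) - p)) with (x - Re p). change (Im ((x, y) - p)) with (y - Im p).
    apply Rplus_le_compat; apply Rabs_le; lra. }
  eapply Rle_trans; [apply H; lra|]. apply Rmult_le_compat_l; lra. }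
assert (H1 : Rabs (RInt (fun y => Re (F (b, y))) c d - RInt (fun y => Re (F (a, y))) c d
  - (d - c) * (Re l * (b - a))) <= (d - c) * (eps * s)).
{ apply RInt_diff_close; [lra| | |].
  - apply (ex_RInt_vertical F a b c d); lra || assumption.
  - apply (ex_RInt_vertical F a b c d); lra || assumption.
  - intros y Hy'.
    assert (A := Hr b y ltac:(lra) Hy'). assert (B := Hr a y ltac:(lra) Hy').
    assert (A' := Rle_trans _ _ _ (re_le_Cmod _) A). assert (B' := Rle_trans _ _ _ (re_le_Cmod _) B).
    match type of A' with Rabs ?u <= _ => match type of B' with Rabs ?v <= _ =>
      replace (Re (F (b, y)) - Re (F (a, y)) - Re l * (b - a)) with (u - v) end end.
    + eapply Rle_trans; [apply Rabs_triang|]. rewrite Rabs_Ropp. lra.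
    + unfold Re, Im; simpl. ring. }
assert (H2 : Rabs (RInt (fun x => Im (F (x, d))) a b - RInt (fun x => Im (F (x, c))) a b
  - (b - a) * (Re l * (d - c))) <= (b - a) * (eps * s)).
{ apply RInt_diff_close; [lra| | |].
  - apply (ex_RInt_horizontal F a b c d); lra || assumption.
  - apply (ex_RInt_horizontal F a b c d); lra || assumption.
  - intros x Hx'.
    assert (A := Hr x d Hx' ltac:(lra)). assert (B := Hr x c Hx' ltac:(lra)).
    assert (A' := Rle_trans _ _ _ (im_le_Cmod _) A). assert (B' := Rle_trans _ _ _ (im_le_Cmod _) B).
    match type of A' with Rabs ?u <= _ => match type of B' with Rabs ?v <= _ =>
      replace (Im (F (x, d)) - Im (F (x, c)) - Re l * (d - c)) with (u - v) end end.
    + eapply Rle_trans; [apply Rabs_triang|]. rewrite Rabs_Ropp. lra.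
    + unfold Re, Im; simpl. ring. }
unfold flux.
match type of H1 with Rabs ?u <= _ => match type of H2 with Rabs ?v <= _ =>
  match goal with |- Rabs ?w <= _ => replace w with (u - v) by ring end end end.
eapply Rle_trans; [apply Rabs_triang|]. rewrite Rabs_Ropp.
replace (eps * s ^ 2) with ((d - c) * (eps * s) + (b - a) * (eps * s)) by (unfold s; ring).
lra.
Qed.

(** Dependent choice along a sequence of predicates. *)
Lemma dependent_choice_nat (A : Type) (P : nat -> A -> Prop) (S' : nat -> A -> A -> Prop) (x0 : A) :
  P 0%nat x0 -> (forall n x, P n x -> exists y, P (S n) y /\ S' n x y) ->
  exists u : nat -> A, u 0%nat = x0 /\ forall n, P n (u n) /\ S' n (u n) (u (S n)).
Proof.
intros H0 HS.
pose (g := fun n x => epsilon (inhabits x0) (fun y => P (S n) y /\ S' n x y)).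
assert (Hg : forall n x, P n x -> P (S n) (g n x) /\ S' n x (g n x)).
{ intros n x Hx; unfold g; apply epsilon_spec, HS, Hx. }
exists (nat_rect (fun _ => A) x0 g); split; [reflexivity|].
assert (HP : forall n, P n (nat_rect (fun _ => A) x0 g n)).
{ intros n; induction n as [|n IH]; [exact H0|]. now apply Hg. }
intros n; split; [apply HP|]. now apply Hg.
Qed.

Lemma nested_intervals (x w : nat -> R) :
  (forall n, 0 <= w n) -> (forall n, x n <= x (S n)) ->
  (forall n, x (S n) + w (S n) <= x n + w n) ->
  exists p, forall n, x n <= p <= x n + w n.
Proof.
intros Hw Hx Hxw.
assert (Hmono : forall n k, x n <= x (n + k)%nat).
{ intros n k; induction k as [|k IH]; [rewrite Nat.add_0_r; lra|].
  rewrite Nat.add_succ_r; eapply Rle_trans; [apply IH|apply Hx]. }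
assert (Hanti : forall n k, x (n + k)%nat + w (n + k)%nat <= x n + w n).
{ intros n k; induction k as [|k IH]; [rewrite Nat.add_0_r; lra|].
  rewrite Nat.add_succ_r; eapply Rle_trans; [apply Hxw|apply IH]. }
assert (Hub : forall n m, x m <= x n + w n).
{ intros n m; destruct (Nat.le_ge_cases n m) as [Hnm|Hnm];
    apply Nat.le_exists_sub in Hnm; destruct Hnm as [k [-> _]]; rewrite Nat.add_comm.
  - assert (A := Hanti n k). assert (B := Hw (n + k)%nat). lra.
  - assert (A := Hmono m k). assert (B := Hw (m + k)%nat). lra. }
destruct (completeness (fun r => exists n, r = x n)) as [p [Hp1 Hp2]].
- exists (x 0%nat + w 0%nat); intros r [n ->]; apply Hub.
- exists (x 0%nat), 0%nat; reflexivity.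
- exists p; intros n; split.
  + apply Hp1; now exists n.
  + apply Hp2; intros r [m ->]; apply Hub.
Qed.

(** If the flux were not zero, repeated quartering would produce rectangles
    shrinking to a point, each with a flux too large for [flux_local]. *)
Lemma Goursat (F : C -> C) (a b c d : R) :
  a <= b -> c <= d -> holo_on_rect F a b c d -> flux F a b c d = 0.
Proof.
intros Hab Hcd HF.
destruct (Req_dec (flux F a b c d) 0) as [E|NE]; [exact E|exfalso].
set (s := (b - a) + (d - c)).
assert (Hs : 0 <= s) by (unfold s; lra).
set (eps := Rabs (flux F a b c d) / (s ^ 2 + 1)).
assert (Hs2 : 0 <= s ^ 2) by apply pow2_ge_0.
assert (Hfl : 0 < Rabs (flux F a b c d)) by now apply Rabs_pos_lt.
assert (Heps : 0 < eps) by (apply Rdiv_lt_0_compat; lra).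
pose (wx := fun n => (b - a) / 2 ^ n). pose (wy := fun n => (d - c) / 2 ^ n).
assert (H2 : forall n, 0 < 2 ^ n) by (intros n; apply pow_lt; lra).
assert (Hwx : forall n, 0 <= wx n).
{ intros n; apply Rmult_le_pos; [lra|apply Rlt_le, Rinv_0_lt_compat, H2]. }
assert (Hwy : forall n, 0 <= wy n).
{ intros n; apply Rmult_le_pos; [lra|apply Rlt_le, Rinv_0_lt_compat, H2]. }
assert (Hwx2 : forall n, wx n = wx (S n) + wx (S n)).
{ intros n; unfold wx; simpl; field. apply Rgt_not_eq, H2. }
assert (Hwy2 : forall n, wy n = wy (S n) + wy (S n)).
{ intros n; unfold wy; simpl; field. apply Rgt_not_eq, H2. }
(* [P n q]: the rectangle with lower left corner [q] and sides [wx n], [wy n] lies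
   in the given one and has a large flux. *)
pose (P := fun n (q : R * R) =>
  (a <= fst q /\ fst q + wx n <= b) /\ (c <= snd q /\ snd q + wy n <= d) /\
  eps * (wx n + wy n) ^ 2 < Rabs (flux F (fst q) (fst q + wx n) (snd q) (snd q + wy n))).
pose (T := fun n (q q' : R * R) =>
  (fst q <= fst q' /\ fst q' + wx (S n) <= fst q + wx n) /\
  (snd q <= snd q' /\ snd q' + wy (S n) <= snd q + wy n)).
destruct (dependent_choice_nat (R * R) P T (a, c)) as [u [_ Hu]].
- unfold P, wx, wy; simpl fst; simpl snd.
  change (2 ^ 0) with 1.
  replace (a + (b - a) / 1) with b by field.
  replace (c + (d - c) / 1) with d by field.
  split; [lra|split; [lra|]].
  replace ((b - a) / 1 + (d - c) / 1) with s by (unfold s; field).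
  apply Rlt_le_trans with (eps * (s ^ 2 + 1)); [nra|].
  right; unfold eps; field; lra.
- intros n [x y] [Hx [Hy Hbig]]; simpl fst in *; simpl snd in *.
  set (x' := x + wx (S n)). set (y' := y + wy (S n)).
  assert (Ex : x + wx n = x' + wx (S n)) by (unfold x'; rewrite Hwx2; ring).
  assert (Ey : y + wy n = y' + wy (S n)) by (unfold y'; rewrite Hwy2; ring).
  assert (Px := Hwx (S n)). assert (Py := Hwy (S n)).
  assert (Hxx : x <= x' <= x' + wx (S n)) by (unfold x' in *; lra).
  assert (Hyy : y <= y' <= y' + wy (S n)) by (unfold y' in *; lra).
  rewrite Ex, Ey in *.
  assert (Hsub : forall a' b' c' d', x <= a' -> b' <= x' + wx (S n) -> y <= c' ->
    d' <= y' + wy (S n) -> holo_on_rect F a' b' c' d').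
  { intros; apply (holo_on_subrect F a b c d); assumption || lra. }
  rewrite (flux_split_x F x x') in Hbig by (apply Hsub || idtac; lra).
  rewrite (flux_split_y F x x' y y'), (flux_split_y F x' (x' + wx (S n)) y y') in Hbig
    by (apply Hsub || idtac; lra).
  rewrite Hwx2, Hwy2 in Hbig.
  set (e := eps * (wx (S n) + wy (S n)) ^ 2).
  replace (eps * (wx (S n) + wx (S n) + (wy (S n) + wy (S n))) ^ 2) with (4 * e) in Hbig
    by (unfold e; ring).
  unfold P, T.
  destruct (Rlt_le_dec e (Rabs (flux F x x' y y'))) as [L1|L1].
  { exists (x, y); simpl fst; simpl snd; fold x' y' e; repeat split; lra. }
  destruct (Rlt_le_dec e (Rabs (flux F x x' y' (y' + wy (S n))))) as [L2|L2].
  { exists (x, y'); simpl fst; simpl snd; fold x' e; repeat split; lra. }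
  destruct (Rlt_le_dec e (Rabs (flux F x' (x' + wx (S n)) y y'))) as [L3|L3].
  { exists (x', y); simpl fst; simpl snd; fold y' e; repeat split; lra. }
  destruct (Rlt_le_dec e (Rabs (flux F x' (x' + wx (S n)) y' (y' + wy (S n))))) as [L4|L4].
  { exists (x', y'); simpl fst; simpl snd; fold e; repeat split; lra. }
  exfalso.
  assert (T1 := Rabs_triang (flux F x x' y y') (flux F x x' y' (y' + wy (S n)))).
  assert (T2 := Rabs_triang (flux F x' (x' + wx (S n)) y y')
                            (flux F x' (x' + wx (S n)) y' (y' + wy (S n)))).
  assert (T3 := Rabs_triang (flux F x x' y y' + flux F x x' y' (y' + wy (S n)))
    (flux F x' (x' + wx (S n)) y y' + flux F x' (x' + wx (S n)) y' (y' + wy (S n)))).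
  lra.
- destruct (nested_intervals (fun n => fst (u n)) wx Hwx) as [p1 Hp1];
    [intros n; apply (Hu n)|intros n; apply (Hu n)|].
  destruct (nested_intervals (fun n => snd (u n)) wy Hwy) as [p2 Hp2];
    [intros n; apply (Hu n)|intros n; apply (Hu n)|].
  destruct (HF p1 p2) as [l Hl].
  { destruct (Hu 0%nat) as [[A _] _]. assert (B := Hp1 0%nat). simpl in B. lra. }
  { destruct (Hu 0%nat) as [[_ [A _]] _]. assert (B := Hp2 0%nat). simpl in B. lra. }
  destruct (flux_local F (p1, p2) l Hl eps Heps) as [delta [Hd Hloc]].
  destruct (pow_lt_1_zero (/ 2) ltac:(rewrite Rabs_pos_eq; lra) (delta / (s + 1))) as [N HN].
  { apply Rdiv_lt_0_compat; lra. }
  specialize (HN N (Nat.le_refl N)).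
  rewrite Rabs_pos_eq in HN by (apply pow_le; lra).
  destruct (Hu N) as [[A [B Cc]] _].
  assert (Hsm : wx N + wy N < delta).
  { replace (wx N + wy N) with (s * (/ 2) ^ N).
    - apply Rle_lt_trans with ((s + 1) * (/ 2) ^ N).
      + assert (Q := pow_le (/ 2) N ltac:(lra)). nra.
      + apply Rmult_lt_compat_l with (r := s + 1) in HN; [|lra].
        replace ((s + 1) * (delta / (s + 1))) with delta in HN by (field; lra). exact HN.
    - unfold wx, wy, s. rewrite pow_inv. field. apply Rgt_not_eq, H2. }
  specialize (Hloc (fst (u N)) (fst (u N) + wx N) (snd (u N)) (snd (u N) + wy N)).
  replace (fst (u N) + wx N - fst (u N) + (snd (u N) + wy N - snd (u N)))
    with (wx N + wy N) in Hloc by ring.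
  assert (X := Hloc (holo_on_subrect F a b c d _ _ _ _ HF (proj1 A) (proj2 A) (proj1 B) (proj2 B))
    (Hp1 N) (Hp2 N) Hsm).
  lra.
Qed.

(** * Circular means and the derivative bound *)

Lemma Cexp_split (u v : C) : Cexp u = (Cexp (u - v) * Cexp v)%C.
Proof. rewrite <- Cexp_plus; f_equal; ring. Qed.

Lemma Cexp_period (x : R) : Cexp (x, 2 * PI) = Cexp (x, 0).
Proof. unfold Cexp; simpl; now rewrite cos_2PI, sin_2PI, cos_0, sin_0. Qed.

(** The two horizontal sides of the rectangle cancel by periodicity. *)
Lemma periodic_mean_constant (F : C -> C) (x1 x2 : R) :
  (forall x y, x1 <= x <= x2 -> exists l, Cder F (x, y) l) ->
  (forall x, F (x, 2 * PI) = F (x, 0)) -> x1 <= x2 ->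
  RInt (fun t => Re (F (x1, t))) 0 (2 * PI) = RInt (fun t => Re (F (x2, t))) 0 (2 * PI).
Proof.
intros HF Hper H12.
assert (HPI := PI_RGT_0).
assert (G : flux F x1 x2 0 (2 * PI) = 0).
{ apply Goursat; [assumption|lra|]. intros x y Hx _; now apply HF. }
unfold flux in G.
rewrite (RInt_ext (fun x => Im (F (x, 2 * PI))) (fun x => Im (F (x, 0)))) in G
  by (intros; now rewrite Hper).
lra.
Qed.

Lemma disc_iff_sqr (z : C) : disc z <-> Re z ^ 2 + Im z ^ 2 < 1.
Proof.
unfold disc; rewrite <- Cmod2_alt. assert (H := Cmod_ge_0 z); split; intros; nra.
Qed.

Lemma RInt_first_harmonic (a b : R) :
  is_RInt (fun t => a * cos t + b * sin t) 0 (2 * PI) 0.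
Proof.
assert (H : is_RInt (fun t => a * cos t + b * sin t) 0 (2 * PI)
  (minus (a * sin (2 * PI) - b * cos (2 * PI)) (a * sin 0 - b * cos 0))).
{ apply (is_RInt_derive (fun t => a * sin t - b * cos t)).
  - intros x _; auto_derive; [trivial|ring].
  - intros x _; apply continuity_pt_filterlim; reg. }
replace (minus (a * sin (2 * PI) - b * cos (2 * PI)) (a * sin 0 - b * cos 0)) with 0 in H; [exact H|].
rewrite cos_2PI, sin_2PI, cos_0, sin_0. unfold minus, plus, opp; simpl; ring.
Qed.

(** The circle of radius [rho] gives the bound with a loss of a factor [rho]. *)
Lemma half_plane_derivative_bound_radius (H : C -> C) (l : C) (rho : R) :
  (forall z, disc z -> exists m, Cder H z m) ->
  (forall z, disc z -> 0 <= Re (H z)) ->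
  Cder H 0 l -> 0 < rho < 1 -> rho * Re l <= 2 * Re (H 0).
Proof.
intros Hhol Hpos Hl Hrho.
assert (HPI := PI_RGT_0).
set (c := RtoC (ln rho)).
assert (Hc : ln rho < 0) by (rewrite <- ln_1; apply ln_increasing; lra).
assert (Hec : Cexp c = rho).
{ unfold Cexp, c; simpl. rewrite exp_ln, cos_0, sin_0 by lra.
  unfold RtoC; f_equal; ring. }
(* [H (z) (2 - z / rho - rho / z)] in the variable [w = log z]. *)
pose (F := fun w => (H (Cexp w) * (2 - Cexp (w - c) - Cexp (c - w)))%C).
assert (HF : forall x y, x < 0 -> exists m, Cder F (x, y) m).
{ intros x y Hx.
  assert (Hd : disc (Cexp (x, y))).
  { unfold disc; rewrite Cmod_Cexp; simpl. rewrite <- exp_0. now apply exp_increasing. }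
  destruct (Hhol _ Hd) as [m Hm].
  eexists; apply (Cder_mult (fun w => H (Cexp w)) (fun w => 2 - Cexp (w - c) - Cexp (c - w))%C).
  - apply (Cder_comp H Cexp); [exact Hm|apply Cder_Cexp].
  - apply (Cder_minus (fun w => 2 - Cexp (w - c))%C (fun w => Cexp (c - w))%C).
    + apply (Cder_minus (fun w => 2)%C (fun w => Cexp (w - c))%C); [apply Cder_const|].
      apply (Cder_comp Cexp (fun w => w - c)%C); [apply Cder_Cexp|].
      apply Cder_minus; [apply Cder_id|apply Cder_const].
    + apply (Cder_comp Cexp (fun w => c - w)%C); [apply Cder_Cexp|].
      apply Cder_minus; [apply Cder_const|apply Cder_id]. }
assert (Hper : forall x, F (x, 2 * PI) = F (x, 0)).
{ intros x; unfold F; rewrite Cexp_period.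
  replace ((x, (2 * PI)%R) - c)%C with (x - ln rho, 2 * PI) by (unfold c, Cminus, Cplus, Copp, RtoC; simpl; f_equal; ring).
  replace ((x, 0) - c)%C with (x - ln rho, 0) by (unfold c, Cminus, Cplus, Copp, RtoC; simpl; f_equal; ring).
  replace (c - (x, (2 * PI)%R))%C with (ln rho - x, - (2 * PI)) by (unfold c, Cminus, Cplus, Copp, RtoC; simpl; f_equal; ring).
  replace (c - (x, 0))%C with (ln rho - x, 0) by (unfold c, Cminus, Cplus, Copp, RtoC; simpl; f_equal; ring).
  rewrite Cexp_period. do 2 f_equal.
  unfold Cexp; simpl. now rewrite cos_neg, sin_neg, cos_2PI, sin_2PI, cos_0, sin_0, Ropp_0. }
assert (Hint : forall x, x < 0 -> ex_RInt (fun t => Re (F (x, t))) 0 (2 * PI)).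
{ intros x Hx; apply (ex_RInt_vertical F x x 0 (2 * PI)); try lra.
  intros x' y' Hx' _; apply HF; lra. }
assert (H0 : 0 <= RInt (fun t => Re (F (ln rho, t))) 0 (2 * PI)).
{ apply RInt_ge_0; [lra|now apply Hint|].
  intros t _; unfold F.
  replace (2 - Cexp ((ln rho, t) - c) - Cexp (c - (ln rho, t)))%C with (RtoC (2 - 2 * cos t)).
  - rewrite re_scal_r. apply Rmult_le_pos.
    + apply Hpos. unfold disc; rewrite Cmod_Cexp; simpl. rewrite exp_ln; lra.
    + assert (A := COS_bound t). lra.
  - unfold Cexp, c, RtoC, Cminus, Cplus, Copp; simpl.
    replace (ln rho + - ln rho) with 0 by ring.
    replace (t + - 0) with t by ring. replace (0 + - t) with (- t) by ring.
    rewrite cos_neg, sin_neg, exp_0. f_equal; ring. }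
apply le_epsilon; intros eps0 Heps0.
set (eps := Rmin 1 (eps0 / 2)).
assert (He : 0 < eps) by (apply Rmin_pos; lra).
assert (He1 : eps <= 1) by apply Rmin_l.
assert (He2 : eps <= eps0 / 2) by apply Rmin_r.
destruct (proj1 (Cder_eps _ _ _) Hl eps He) as [d [Hd HR]].
set (M := Cmod l + 1).
assert (HM : 1 <= M) by (assert (A := Cmod_ge_0 l); unfold M; lra).
set (B := 2 * M + (Cmod (H 0) + M) / rho).
assert (A0 := Cmod_ge_0 (H 0)).
assert (HB : 0 < B).
{ unfold B. assert (0 < (Cmod (H 0) + M) / rho) by (apply Rdiv_lt_0_compat; lra). lra. }
(* The radius [r] is so small that the higher order terms are negligible. *)
set (r := Rmin (Rmin (d / 2) (rho / 2)) (eps / B)).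
assert (Hr : 0 < r).
{ apply Rmin_pos; [apply Rmin_pos; lra|now apply Rdiv_lt_0_compat]. }
assert (Hr1 : r <= d / 2) by (eapply Rle_trans; [apply Rmin_l|apply Rmin_l]).
assert (Hr2 : r <= rho / 2) by (eapply Rle_trans; [apply Rmin_l|apply Rmin_r]).
assert (Hr3 : B * r <= eps).
{ assert (A : r <= eps / B) by apply Rmin_r.
  apply Rmult_le_compat_l with (r := B) in A; [|lra].
  replace (B * (eps / B)) with eps in A by (field; lra). exact A. }
assert (Hx : ln r < ln rho) by (apply ln_increasing; lra).
set (x := ln r) in *.
assert (Hex : exp x = r) by (now apply exp_ln).
(* Up to [2 * eps], [k] is the limit of the means over shrinking circles. *)
set (k := 2 * Re (H 0) - rho * Re l + 2 * eps).
assert (Hle : RInt (fun t => Re (F (x, t))) 0 (2 * PI) <= 2 * PI * k).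
{ set (g := fun t => k - rho * exp (- x) * (Re (H 0) * cos t + Im (H 0) * sin t)).
  assert (Hg : is_RInt g 0 (2 * PI) (2 * PI * k)).
  { assert (E : (2 * PI * k) = minus (scal (2 * PI - 0) k) (scal (rho * exp (- x)) 0)).
    { unfold minus, plus, opp, scal; simpl; unfold mult; simpl; ring. }
    rewrite E. apply (is_RInt_minus (V := R_NormedModule)).
    - apply (is_RInt_const (V := R_NormedModule)).
    - apply (is_RInt_scal (V := R_NormedModule)). apply RInt_first_harmonic. }
  rewrite <- (is_RInt_unique _ _ _ _ Hg).
  apply RInt_le; [lra|apply Hint; lra|eexists; exact Hg|].
  intros t _.
  set (z := Cexp (x, t)).
  assert (Hz : Cmod z = r) by (unfold z; rewrite Cmod_Cexp; exact Hex).
  assert (Hz0 : z <> 0) by (apply Cmod_gt_0; lra).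
  assert (Hrho0 : RtoC rho <> 0) by (intros E; apply RtoC_inj in E; lra).
  assert (Ez1 : Cexp ((x, t) - c) = (z / rho)%C).
  { unfold z; rewrite <- Hec.
    assert (E : Cexp (x, t) = (Cexp ((x, t) - c) * Cexp c)%C) by apply Cexp_split.
    rewrite E; field. rewrite Hec; exact Hrho0. }
  assert (Ez2 : Cexp (c - (x, t)) = (rho / z)%C).
  { unfold z; rewrite <- Hec.
    assert (E : Cexp c = (Cexp (c - (x, t)) * Cexp (x, t))%C) by apply Cexp_split.
    rewrite E; field. exact Hz0. }
  assert (Ezi : Cexp (-x, -t)%R = (/ z)%C).
  { assert (E : (Cexp (-x, -t)%R * z)%C = 1).
    { unfold z; rewrite <- Cexp_plus.
      replace ((- x, - t)%R + (x, t))%C with (RtoC 0) by (unfold Cplus, RtoC; simpl; f_equal; ring).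
      unfold Cexp, RtoC; simpl. rewrite exp_0, cos_0, sin_0; f_equal; ring. }
    rewrite <- (Cmult_1_r (Cexp (-x, -t)%R)), <- (Cinv_r z), Cmult_assoc, E by exact Hz0; ring. }
  assert (HRz := HR z).
  replace (z - 0)%C with z in HRz by ring.
  rewrite Hz in HRz. specialize (HRz ltac:(lra)).
  set (R1 := (H z - H 0 - l * z)%C) in *.
  (* Only the term in [1 / z] is large; its mean is zero. *)
  assert (Edec : F (x, t) = (2 * H 0 - rho * l - rho * (H 0 * Cexp (-x, -t)%R)
     + (2 * (l * z + R1) - H z * (z / rho) - rho * (R1 / z)))%C).
  { unfold F; rewrite Ez1, Ez2, Ezi. fold z. unfold R1. field. now split. }
  set (err := (2 * (l * z + R1) - H z * (z / rho) - rho * (R1 / z))%C) in *.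
  assert (Hlz : Cmod (l * z + R1) <= M * r).
  { eapply Rle_trans; [apply Cmod_triangle|]. rewrite Cmod_mult, Hz. unfold M.
    assert (eps * r <= 1 * r) by (apply Rmult_le_compat_r; lra). lra. }
  assert (HHz : Cmod (H z) <= Cmod (H 0) + M).
  { replace (H z) with (H 0 + (l * z + R1))%C by (unfold R1; ring).
    eapply Rle_trans; [apply Cmod_triangle|]. nra. }
  assert (Herr : Cmod err <= 2 * eps).
  { unfold err, Cminus.
    eapply Rle_trans; [apply Cmod_triangle|].
    assert (T1 := Cmod_triangle (2 * (l * z + R1)) (- (H z * (z / rho)))).
    rewrite !Cmod_opp in *. rewrite !Cmod_mult, !Cmod_div in * by assumption.
    rewrite !Cmod_R in *. rewrite Hz, (Rabs_pos_eq 2), (Rabs_pos_eq rho) in * by lra.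
    assert (Q1 : Cmod (H z) * (r / rho) <= (Cmod (H 0) + M) * (r / rho)).
    { apply Rmult_le_compat_r; [apply Rlt_le, Rdiv_lt_0_compat; lra|exact HHz]. }
    assert (Q2 : Cmod R1 / r <= eps).
    { apply Rmult_le_reg_r with r; [lra|]. unfold Rdiv; rewrite Rmult_assoc, Rinv_l by lra. lra. }
    assert (Q3 : B * r = 2 * (M * r) + (Cmod (H 0) + M) * (r / rho)) by (unfold B; field; lra).
    assert (Q4 : 0 <= Cmod R1 / r) by (apply Rmult_le_pos; [apply Cmod_ge_0|apply Rlt_le, Rinv_0_lt_compat; lra]).
    nra. }
  assert (Hre := Rle_trans _ _ _ (Rle_abs _) (Rle_trans _ _ _ (re_le_Cmod err) Herr)).
  rewrite Edec, re_plus.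
  unfold g, k.
  replace (Re (2 * H 0 - rho * l - rho * (H 0 * Cexp (-x, -t)%R)))
    with (2 * Re (H 0) - rho * Re l - rho * exp (- x) * (Re (H 0) * cos t + Im (H 0) * sin t)).
  - lra.
  - unfold Cexp; simpl; rewrite cos_neg, sin_neg; unfold Re, Im; ring. }
assert (Heq : RInt (fun t => Re (F (x, t))) 0 (2 * PI) = RInt (fun t => Re (F (ln rho, t))) 0 (2 * PI)).
{ apply periodic_mean_constant; [|exact Hper|lra]. intros x' y Hx'; apply HF; lra. }
assert (Hk : 0 <= k).
{ apply Rmult_le_reg_l with (2 * PI); lra. }
unfold k in Hk. lra.
Qed.

(** At the centre of the disc, the derivative of a holomorphic map to the right
    half-plane has real part at most twice that of its value. *)
Lemma half_plane_derivative_bound (H : C -> C) (l : C) :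
  (forall z, disc z -> exists m, Cder H z m) ->
  (forall z, disc z -> 0 <= Re (H z)) ->
  Cder H 0 l -> Re l <= 2 * Re (H 0).
Proof.
intros Hhol Hpos Hl.
destruct (Rle_lt_dec (Re l) (2 * Re (H 0))) as [Hle|Hlt]; [exact Hle|exfalso].
assert (H0 : 0 <= Re (H 0)) by (apply Hpos; unfold disc; rewrite Cmod_0; lra).
assert (A : forall rho, 0 < rho < 1 -> rho * Re l <= 2 * Re (H 0))
  by (intros rho Hrho; now apply half_plane_derivative_bound_radius).
(* A radius [rho] so close to [1] that [rho * Re l] still exceeds the bound. *)
assert (B := A (/ 2 + Re (H 0) / Re l)).
assert (E : Re (H 0) / Re l < / 2).
{ apply Rmult_lt_reg_r with (Re l); [lra|]. unfold Rdiv; rewrite Rmult_assoc, Rinv_l; lra. }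
assert (E0 : 0 <= Re (H 0) / Re l) by (apply Rmult_le_pos; [lra|apply Rlt_le, Rinv_0_lt_compat; lra]).
specialize (B ltac:(lra)).
rewrite Rmult_plus_distr_r in B. unfold Rdiv in B; rewrite Rmult_assoc, Rinv_l in B by lra. lra.
Qed.

(** * Harnack's inequality *)

Lemma Cder_real_line (h : C -> C) (s : R) (l : C) :
  Cder h s l -> is_derive (fun t : R => Re (h t)) s (Re l).
Proof.
intros Hl; apply is_derive_Reals; intros eps Heps.
destruct (proj1 (Cder_eps _ _ _) Hl (eps / 2) ltac:(lra)) as [d [Hd H]].
exists (mkposreal d Hd); intros k Hk Hkd; simpl in Hkd.
assert (Ek : (RtoC (s + k) - RtoC s)%C = RtoC k) by (rewrite <- RtoC_minus; f_equal; ring).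
specialize (H (RtoC (s + k))); rewrite Ek, Cmod_R in H.
specialize (H Hkd).
assert (A := Rle_trans _ _ _ (re_le_Cmod _) H).
assert (Hk0 : 0 < Rabs k) by now apply Rabs_pos_lt.
replace ((Re (h (s + k)%R) - Re (h s)) / k - Re l)
  with (Re (h (s + k)%R - h s - l * k) / k).
- unfold Rdiv; rewrite Rabs_mult, Rabs_inv.
  apply Rle_lt_trans with (eps / 2); [|lra].
  apply Rmult_le_reg_r with (Rabs k); [exact Hk0|].
  rewrite Rmult_assoc, Rinv_l, Rmult_1_r by lra. exact A.
- replace (Re (h (s + k)%R - h s - l * k)) with (Re (h (s + k)%R) - Re (h s) - Re l * k)
    by (unfold Re, Im; simpl; ring).
  field. exact Hk.
Qed.

Lemma disc_real (s : R) : 0 <= s < 1 -> disc s.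
Proof. intros Hs; unfold disc; rewrite Cmod_R, Rabs_pos_eq; lra. Qed.

(** [half_plane_derivative_bound] moved to the point [s] by the disc automorphism
    [z |-> (z + s) / (1 + s z)], whose derivative at [0] is [1 - s^2]. *)
Lemma half_plane_derivative_bound_at (h : C -> C) (s : R) (l : C) :
  (forall z, disc z -> exists m, Cder h z m) ->
  (forall z, disc z -> 0 <= Re (h z)) ->
  0 <= s < 1 -> Cder h s l -> (1 - s * s) * Re l <= 2 * Re (h s).
Proof.
intros Hhol Hpos Hs Hl.
assert (Hden : forall z, disc z -> (1 + s * z)%C <> 0).
{ intros z Hz E. assert (H : Re (1 + s * z) = 0) by now rewrite E.
  apply disc_iff_sqr in Hz. unfold Re in H; simpl in H. unfold Re, Im in Hz. nra. }
assert (HT : forall z, disc z -> disc ((z + s) / (1 + s * z))%C).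
{ intros z Hz; unfold disc. rewrite Cmod_div by now apply Hden.
  assert (Hp : 0 < Cmod (1 + s * z)) by now apply Cmod_gt_0, Hden.
  apply Rmult_lt_reg_r with (Cmod (1 + s * z)); [exact Hp|].
  unfold Rdiv; rewrite Rmult_assoc, Rinv_l, Rmult_1_l, Rmult_1_r by lra.
  apply Rsqr_incrst_0; [|apply Cmod_ge_0|lra].
  rewrite !Rsqr_pow2, !Cmod2_alt.
  apply disc_iff_sqr in Hz. unfold Re, Im in *; simpl.
  assert (0 < (1 - s * s) * (1 - (fst z ^ 2 + snd z ^ 2))) by (apply Rmult_lt_0_compat; nra).
  simpl in *; nra. }
assert (HdT : forall z, disc z -> Cder (fun z => (z + s) / (1 + s * z))%C z
   (((1 + 0) * (1 + s * z) - (z + s) * (0 + (0 * z + s * 1))) / ((1 + s * z) * (1 + s * z)))%C).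
{ intros z Hz.
  apply (Cder_div (fun z => z + s)%C (fun z => 1 + s * z)%C); [now apply Hden| |].
  - apply Cder_plus; [apply Cder_id|apply Cder_const].
  - apply (Cder_plus (fun _ => 1)%C (fun z => s * z)%C); [apply Cder_const|].
    apply (Cder_mult (fun _ => RtoC s) (fun z => z)); [apply Cder_const|apply Cder_id]. }
assert (H0 : disc 0) by (unfold disc; rewrite Cmod_0; lra).
assert (E0 : ((0 + s) / (1 + s * 0))%C = s) by (field; intros E; apply RtoC_inj in E; lra).
assert (A := half_plane_derivative_bound (fun z => h ((z + s) / (1 + s * z))%C)
  (((1 + 0) * (1 + s * 0) - (0 + s) * (0 + (0 * 0 + s * 1))) / ((1 + s * 0) * (1 + s * 0)) * l)%C).
cbv beta in A; rewrite E0 in A.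
replace (((1 + 0) * (1 + s * 0) - (0 + s) * (0 + (0 * 0 + s * 1))) / ((1 + s * 0) * (1 + s * 0)) * l)%C
  with (RtoC (1 - s * s) * l)%C in A
  by (rewrite RtoC_minus, RtoC_mult; field; intros E; apply RtoC_inj in E; lra).
rewrite re_scal_l in A. apply A.
- intros z Hz; destruct (Hhol _ (HT z Hz)) as [m Hm].
  eexists; apply (Cder_comp h (fun z => (z + s) / (1 + s * z))%C); [exact Hm|now apply HdT].
- intros z Hz; now apply Hpos, HT.
- assert (B := HdT 0 H0).
  apply (Cder_comp h (fun z => (z + s) / (1 + s * z))%C 0 l) in B; [|cbv beta; now rewrite E0].
  replace (RtoC (1 - s * s) * l)%C with
   (((1 + 0) * (1 + s * 0) - (0 + s) * (0 + (0 * 0 + s * 1))) / ((1 + s * 0) * (1 + s * 0)) * l)%C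
   by (rewrite RtoC_minus, RtoC_mult; field; intros E; apply RtoC_inj in E; lra).
  exact B.
Qed.

(** Harnack's inequality along the positive radius. *)
Lemma Harnack (h : C -> C) (r : R) :
  (forall z, disc z -> exists m, Cder h z m) ->
  (forall z, disc z -> 0 <= Re (h z)) ->
  0 <= r < 1 -> (1 - r) * Re (h r) <= (1 + r) * Re (h 0).
Proof.
intros Hhol Hpos Hr.
set (y := fun s : R => Re (h s)).
assert (Hy : forall s, 0 <= s < 1 -> exists l, is_derive y s l /\ (1 - s * s) * l <= 2 * y s).
{ intros s Hs; destruct (Hhol _ (disc_real s Hs)) as [l Hl].
  exists (Re l); split; [now apply Cder_real_line|].
  now apply half_plane_derivative_bound_at. }
(* [half_plane_derivative_bound_at] says that this function is nonincreasing. *)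
set (g := fun s => y s * ((1 - s) / (1 + s))).
assert (Hg : forall s, 0 <= s < 1 -> is_derive g s
   (Derive y s * ((1 - s) / (1 + s)) + y s * (- 2 / (1 + s) ^ 2))).
{ intros s Hs; destruct (Hy s Hs) as [l [Hl _]].
  apply (is_derive_mult y (fun s => (1 - s) / (1 + s))).
  - apply Derive_correct; now exists l.
  - auto_derive; [lra|field; lra].
  - intros; apply Rmult_comm. }
destruct (MVT_gen g 0 r (fun s => Derive y s * ((1 - s) / (1 + s)) + y s * (- 2 / (1 + s) ^ 2)))
  as [s [Hs E]].
- rewrite Rmin_left, Rmax_right by lra. intros s Hs; apply Hg; lra.
- rewrite Rmin_left, Rmax_right by lra. intros s Hs.
  apply derivable_continuous_pt. eexists. apply is_derive_Reals, Hg; lra.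
- rewrite Rmin_left, Rmax_right in Hs by lra.
  destruct (Hy s ltac:(lra)) as [l [Hl Hle]].
  rewrite (is_derive_unique _ _ _ Hl) in E.
  replace (l * ((1 - s) / (1 + s)) + y s * (- 2 / (1 + s) ^ 2))
    with (((1 - s * s) * l - 2 * y s) / (1 + s) ^ 2) in E by (field; lra).
  assert (Hneg : ((1 - s * s) * l - 2 * y s) / (1 + s) ^ 2 <= 0).
  { assert (0 < / (1 + s) ^ 2) by (apply Rinv_0_lt_compat, pow_lt; lra). unfold Rdiv; nra. }
  assert (Hgr : g r <= g 0) by nra.
  unfold g in Hgr.
  apply Rmult_le_compat_l with (r := 1 + r) in Hgr; [|lra].
  replace ((1 + r) * (y r * ((1 - r) / (1 + r)))) with ((1 - r) * y r) in Hgr by (field; lra).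
  replace ((1 - 0) / (1 + 0)) with 1 in Hgr by field. 
  unfold y in Hgr. lra.
Qed.

(** * Julia's inequality *)

Lemma re_Cayley (sigma w : C) : Cmod sigma = 1 -> sigma <> w ->
  Re ((sigma + w) / (sigma - w)) = (1 - Cmod w ^ 2) / Cmod (sigma - w) ^ 2.
Proof.
intros Hs Hw.
assert (Hs2 : Re sigma ^ 2 + Im sigma ^ 2 = 1) by (rewrite <- Cmod2_alt, Hs; ring).
assert (Hne : (sigma - w)%C <> 0) by now apply Cminus_eq_contra.
assert (Hpos : 0 < Cmod (sigma - w) ^ 2) by now apply pow_lt, Cmod_gt_0.
rewrite <- Hs2. revert Hpos; rewrite !Cmod2_alt.
destruct sigma as [s1 s2], w as [w1 w2]; unfold Re, Im; simpl; intros Hpos.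
field. lra.
Qed.

(** Harnack's inequality for the Cayley transform of a self-map of the disc. *)
Lemma Harnack_self_map (f : C -> C) (sigma z : C) :
  holomorphic_self_map f -> Cmod sigma = 1 -> disc z ->
  (1 - Cmod z) * ((1 - Cmod (f z) ^ 2) / Cmod (sigma - f z) ^ 2)
    <= (1 + Cmod z) * ((1 - Cmod (f 0) ^ 2) / Cmod (sigma - f 0) ^ 2).
Proof.
intros [Hself Hhol] Hs Hz.
(* A rotation brings [z] to the positive radius. *)
assert (Hex : exists e, Cmod e = 1 /\ z = (e * Cmod z)%C).
{ destruct (Ceq_dec z 0) as [->|Hz0].
  - exists 1; rewrite Cmod_1, Cmod_0; split; [reflexivity|ring].
  - assert (Hm : 0 < Cmod z) by now apply Cmod_gt_0.
    assert (Hm' : RtoC (Cmod z) <> 0) by (intros E; apply RtoC_inj in E; lra).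
    exists (z / Cmod z)%C; split.
    + rewrite Cmod_div, Cmod_R, Rabs_pos_eq by (assumption || lra). field; lra.
    + field; exact Hm'. }
destruct Hex as [e [He Ez]].
assert (Hed : forall u, disc u -> disc (e * u)%C) by (intros u; unfold disc; now rewrite Cmod_mult, He, Rmult_1_l).
assert (Hne : forall u, disc u -> sigma <> u) by (intros u Hu E; unfold disc in Hu; rewrite <- E in Hu; lra).
assert (HC : forall u, disc u -> 0 <= (1 - Cmod u ^ 2) / Cmod (sigma - u) ^ 2).
{ intros u Hu; apply Rmult_le_pos.
  - unfold disc in Hu; assert (A := Cmod_ge_0 u). nra.
  - apply Rlt_le, Rinv_0_lt_compat, pow_lt, Cmod_gt_0, Cminus_eq_contra, Hne, Hu. }
assert (A := Harnack (fun u => (sigma + f (e * u)) / (sigma - f (e * u)))%C (Cmod z)).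
cbv beta in A.
rewrite Cmult_0_r, <- Ez, !re_Cayley in A.
- apply A.
  + intros u Hu. destruct (Hhol _ (Hed u Hu)) as [l Hl]. apply is_derive_Cder in Hl.
    assert (D : Cder (fun u => f (e * u)%C) u ((0 * u + e * 1) * l)%C).
    { apply (Cder_comp f (fun u => e * u)%C); [exact Hl|].
      apply (Cder_mult (fun _ => e) (fun u => u)); [apply Cder_const|apply Cder_id]. }
    eexists; apply (Cder_div (fun u => sigma + f (e * u))%C (fun u => sigma - f (e * u))%C).
    * now apply Cminus_eq_contra, Hne, Hself, Hed.
    * apply Cder_plus; [apply Cder_const|exact D].
    * apply Cder_minus; [apply Cder_const|exact D].
  + intros u Hu; rewrite re_Cayley; [|assumption|now apply Hne, Hself, Hed].
    now apply HC, Hself, Hed.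
  + split; [apply Cmod_ge_0|exact Hz].
- exact Hs.
- apply Hne, Hself. unfold disc; rewrite Cmod_0; lra.
- exact Hs.
- now apply Hne, Hself.
Qed.

Lemma Denjoy_Wolff_limit (phi : R -> C -> C) (tau : C) :
  Denjoy_Wolff_point phi tau -> forall eps, 0 < eps ->
  exists M, forall t, M < t -> Cmod (phi t 0 - tau) < eps.
Proof.
intros [_ H] eps Heps.
assert (H0 : disc 0) by (unfold disc; rewrite Cmod_0; lra).
destruct (proj1 (filterlim_locally _ _) (H 0 H0) (mkposreal (eps / 2) ltac:(lra))) as [M HM].
exists M; intros t Ht; destruct (HM t Ht) as [B1 B2].
change (Rabs (fst (phi t 0) - fst tau) < eps / 2) in B1.
change (Rabs (snd (phi t 0) - snd tau) < eps / 2) in B2.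
eapply Rle_lt_trans; [apply Cmod_le_abs|].
change (Rabs (fst (phi t 0) - fst tau) + Rabs (snd (phi t 0) - snd tau) < eps). lra.
Qed.

(** A sequence of the disc converging to the unit circle has arbitrarily large
    indices at which its modulus does not decrease. *)
Lemma modulus_increases (Z : nat -> C) (tau : C) : Cmod tau = 1 ->
  (forall n, disc (Z n)) ->
  (forall eps, 0 < eps -> exists N, forall n, (N <= n)%nat -> Cmod (Z n - tau) < eps) ->
  forall N, exists n, (N <= n)%nat /\ Cmod (Z n) <= Cmod (Z (S n)).
Proof.
intros Ht HZ Hlim N.
destruct (classic (exists n, (N <= n)%nat /\ Cmod (Z n) <= Cmod (Z (S n)))) as [H|H]; [exact H|exfalso].
assert (Hdec : forall k, Cmod (Z (N + k)%nat) <= Cmod (Z N)).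
{ intros k; induction k as [|k IH]; [rewrite Nat.add_0_r; lra|].
  rewrite Nat.add_succ_r.
  destruct (Rle_lt_dec (Cmod (Z (N + k)%nat)) (Cmod (Z (S (N + k))))) as [L|L]; [|lra].
  exfalso; apply H; exists (N + k)%nat; split; [lia|exact L]. }
destruct (Hlim (1 - Cmod (Z N))) as [K HK]; [assert (A := HZ N); unfold disc in A; lra|].
specialize (HK (N + K)%nat ltac:(lia)).
assert (A := Cmod_triangle (Z (N + K)%nat) (- (Z (N + K)%nat - tau))).
replace (Z (N + K)%nat + - (Z (N + K)%nat - tau))%C with tau in A by ring.
rewrite Cmod_opp, Ht in A. assert (B := Hdec K). lra.
Qed.

(** The orbit of [0] stays in the closed horodisc of centre [tau] through [0]. *)
Lemma Julia (phi : R -> C -> C) (tau : C) :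
  nonelliptic_semigroup phi -> Denjoy_Wolff_point phi tau ->
  forall t, 0 <= t -> Cmod (tau - phi t 0) ^ 2 <= 1 - Cmod (phi t 0) ^ 2.
Proof.
intros Hsg HDW t Ht.
assert (Htau : Cmod tau = 1) by apply HDW.
assert (H0 : disc 0) by (unfold disc; rewrite Cmod_0; lra).
destruct (Req_dec t 0) as [->|Ht0].
{ rewrite (sg_id _ Hsg) by exact H0. unfold Cminus; rewrite Copp_0, Cplus_0_r, Htau, Cmod_0; lra. }
assert (Htp : 0 < t) by lra.
assert (Hhol := sg_holomorphic _ Hsg t Ht).
pose (Z := fun n => phi (INR n * t) 0).
assert (Hnt : forall n, 0 <= INR n * t) by (intros n; apply Rmult_le_pos; [apply pos_INR|exact Ht]).
assert (HZ : forall n, disc (Z n)) by (intros n; now apply (sg_holomorphic _ Hsg)).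
assert (HZS : forall n, Z (S n) = phi t (Z n)).
{ intros n; unfold Z; rewrite <- (sg_comp _ Hsg) by auto. f_equal. rewrite S_INR; ring. }
assert (Hlim : forall eps, 0 < eps -> exists N, forall n, (N <= n)%nat -> Cmod (Z n - tau) < eps).
{ intros eps Heps; destruct (Denjoy_Wolff_limit _ _ HDW eps Heps) as [M HM].
  destruct (INR_unbounded (M / t)) as [N HN].
  exists N; intros n Hn; apply HM.
  apply Rlt_le_trans with (INR N * t).
  - apply Rmult_lt_compat_r with (r := t) in HN; [|exact Htp].
    unfold Rdiv in HN; rewrite Rmult_assoc, Rinv_l, Rmult_1_r in HN; lra.
  - apply Rmult_le_compat_r; [exact Ht|]. now apply le_INR. }
set (z0 := phi t 0) in *.
assert (Hz0 : disc z0) by now apply Hhol.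
assert (Hq0 : 0 <= 1 - Cmod z0 ^ 2) by (unfold disc in Hz0; assert (A := Cmod_ge_0 z0); nra).
set (q := sqrt (1 - Cmod z0 ^ 2)).
assert (Hq : q ^ 2 = 1 - Cmod z0 ^ 2) by now apply pow2_sqrt.
rewrite <- Hq.
apply pow_incr; split; [apply Cmod_ge_0|].
apply le_epsilon; intros eps Heps.
destruct (Hlim (Rmin (eps / 2) 1)) as [N HN]; [apply Rmin_pos; lra|].
destruct (modulus_increases Z tau Htau HZ Hlim N) as [n [Hn Hinc]].
specialize (HN (S n) ltac:(lia)).
apply Rmin_Rgt_l in HN; destruct HN as [HN1 HN2].
set (z := Z n) in *. set (z' := Z (S n)) in *.
assert (Hz' := HZ (S n)). fold z' in Hz'. assert (Hz := HZ n). fold z in Hz. unfold disc in Hz, Hz', Hz0.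
assert (Htr := Cmod_triangle z' (- (z' - tau))).
replace (z' + - (z' - tau))%C with tau in Htr by ring.
rewrite Cmod_opp, Htau in Htr.
assert (Hm' : 0 < Cmod z') by lra.
assert (Hmc : RtoC (Cmod z') <> 0) by (intros E; apply RtoC_inj in E; lra).
(* The boundary point in the direction of the next iterate. *)
set (sigma := (z' / Cmod z')%C).
assert (Hs : Cmod sigma = 1).
{ unfold sigma; rewrite Cmod_div, Cmod_R, Rabs_pos_eq by (assumption || lra). field; lra. }
assert (Hsz : Cmod (sigma - z') = 1 - Cmod z').
{ replace (sigma - z')%C with (sigma * RtoC (1 - Cmod z'))%C
    by (rewrite RtoC_minus; unfold sigma; field; exact Hmc).
  rewrite Cmod_mult, Hs, Cmod_R, Rabs_pos_eq; lra. }
assert (HH := Harnack_self_map (phi t) sigma z Hhol Hs Hz).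
unfold z in HH; rewrite <- HZS in HH; fold z z' z0 in HH.
assert (Hs0 : 0 < Cmod (sigma - z0)).
{ apply Cmod_gt_0, Cminus_eq_contra. intros E; rewrite <- E, Hs in Hz0; lra. }
assert (Hsq : Cmod (sigma - z0) <= q).
{ apply Rsqr_incr_0; [|lra|apply sqrt_pos].
  rewrite !Rsqr_pow2, Hq.
  rewrite Hsz in HH.
  replace ((1 - Cmod z' ^ 2) / (1 - Cmod z') ^ 2) with ((1 + Cmod z') / (1 - Cmod z')) in HH by (field; lra).
  assert (Hp : 0 < Cmod (sigma - z0) ^ 2) by now apply pow_lt.
  set (b := Cmod (sigma - z0) ^ 2) in *. set (a := 1 - Cmod z0 ^ 2) in *.
  assert (HH' : (1 - Cmod z) * (1 + Cmod z') * b <= (1 + Cmod z) * (1 - Cmod z') * a).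
  { apply Rmult_le_compat_r with (r := (1 - Cmod z') * b) in HH; [|apply Rmult_le_pos; lra].
    replace ((1 - Cmod z) * ((1 + Cmod z') / (1 - Cmod z')) * ((1 - Cmod z') * b))
      with ((1 - Cmod z) * (1 + Cmod z') * b) in HH by (field; lra).
    replace ((1 + Cmod z) * (a / b) * ((1 - Cmod z') * b))
      with ((1 + Cmod z) * (1 - Cmod z') * a) in HH by (field; lra).
    exact HH. }
  assert (Hzp : 0 < (1 - Cmod z) * (1 + Cmod z')) by (apply Rmult_lt_0_compat; lra).
  apply Rmult_le_reg_l with ((1 - Cmod z) * (1 + Cmod z')); [exact Hzp|].
  eapply Rle_trans; [exact HH'|]. apply Rmult_le_compat_r; [exact Hq0|]. nra. }
assert (T1 := Cmod_triangle (sigma - z0) (- ((sigma - z') + (z' - tau)))).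
replace (sigma - z0 + - ((sigma - z') + (z' - tau)))%C with (tau - z0)%C in T1 by ring.
rewrite Cmod_opp in T1.
assert (T2 := Cmod_triangle (sigma - z') (z' - tau)).
lra.
Qed.

(** * Projection to the diameter *)

(** The hyperbolic distance as a function of the pseudo-hyperbolic distance [x]. *)
Definition hyp (x : R) : R := / 2 * ln ((1 + x) / (1 - x)).

Lemma hyp_lt (x y : R) : 0 <= x -> x < y -> y < 1 -> hyp x < hyp y.
Proof.
intros Hx Hxy Hy; unfold hyp; apply Rmult_lt_compat_l; [lra|].
apply ln_increasing; [apply Rdiv_lt_0_compat; lra|].
apply Rmult_lt_reg_r with ((1 - x) * (1 - y)); [apply Rmult_lt_0_compat; lra|].
replace ((1 + x) / (1 - x) * ((1 - x) * (1 - y))) with ((1 + x) * (1 - y)) by (field; lra).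
replace ((1 + y) / (1 - y) * ((1 - x) * (1 - y))) with ((1 + y) * (1 - x)) by (field; lra).
nra.
Qed.

Lemma hyp_le (x y : R) : 0 <= x -> x <= y -> y < 1 -> hyp x <= hyp y.
Proof.
intros Hx [Hxy| ->] Hy; [now apply Rlt_le, hyp_lt|apply Rle_refl].
Qed.

Lemma omega_0 (w : C) : omega 0 w = hyp (Cmod w).
Proof.
unfold omega, Tmap, hyp.
replace ((0 - w) / (1 - Cconj 0 * w))%C with (- w)%C; [now rewrite Cmod_opp|].
replace (Cconj 0) with (RtoC 0) by (unfold Cconj, RtoC; simpl; f_equal; ring).
field.
Qed.

(** The coordinate of [z] along the diameter through [tau]. *)
Definition axial (tau z : C) : R := Re tau * Re z + Im tau * Im z.

Lemma unit_sqr (tau : C) : Cmod tau = 1 -> Re tau ^ 2 + Im tau ^ 2 = 1.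
Proof. intros H; rewrite <- Cmod2_alt, H; ring. Qed.

Lemma disc_sqr_bounds (z : C) : disc z -> 0 <= Cmod z ^ 2 < 1.
Proof.
intros Hz; split; [apply pow2_ge_0|]. rewrite Cmod2_alt. now apply disc_iff_sqr.
Qed.

Lemma axial_sqr_le (tau z : C) : Cmod tau = 1 -> axial tau z ^ 2 <= Cmod z ^ 2.
Proof.
intros Htau; rewrite Cmod2_alt. assert (T := unit_sqr tau Htau). unfold axial.
assert (0 <= (Re tau * Im z - Im tau * Re z) ^ 2) by apply pow2_ge_0.
replace (Re z ^ 2 + Im z ^ 2) with ((Re tau ^ 2 + Im tau ^ 2) * (Re z ^ 2 + Im z ^ 2))
  by (rewrite T; ring).
nra.
Qed.

Lemma Tmap_denominator_pos (a m r : R) : a ^ 2 <= m -> m < 1 -> -1 < r < 1 ->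
  0 < 1 - 2 * a * r + m * r ^ 2.
Proof.
intros A M Hr.
assert (0 <= (1 - a * r) ^ 2) by apply pow2_ge_0.
assert (Hr2 : 0 <= r ^ 2 < 1) by (split; nra).
assert (Ha : 0 <= a ^ 2) by apply pow2_ge_0.
assert (Har : (a * r) ^ 2 < 1) by nra.
assert (a * r < 1) by nra.
assert (0 < (1 - a * r) ^ 2) by (apply pow_lt; lra).
nra.
Qed.

Lemma Cmod_Tmap_geodesic (tau z : C) (r : R) : Cmod tau = 1 -> disc z -> -1 < r < 1 ->
  1 - Cmod (Tmap z (geodesic tau r)) ^ 2 =
  (1 - Cmod z ^ 2) * ((1 - r ^ 2) / (1 - 2 * axial tau z * r + Cmod z ^ 2 * r ^ 2)).
Proof.
intros Htau Hz Hr.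
assert (D := Tmap_denominator_pos _ _ r (axial_sqr_le tau z Htau) (proj2 (disc_sqr_bounds z Hz)) Hr).
assert (T := unit_sqr tau Htau).
assert (E1 : Cmod (z - geodesic tau r) ^ 2 = Cmod z ^ 2 - 2 * axial tau z * r + r ^ 2).
{ rewrite !Cmod2_alt. unfold axial.
  replace (r ^ 2) with (r ^ 2 * (Re tau ^ 2 + Im tau ^ 2)) by (rewrite T; ring).
  unfold geodesic, Re, Im; simpl; ring. }
assert (E2 : Cmod (1 - Cconj z * geodesic tau r) ^ 2
             = 1 - 2 * axial tau z * r + Cmod z ^ 2 * r ^ 2).
{ rewrite !Cmod2_alt. unfold axial.
  replace (r ^ 2) with (r ^ 2 * (Re tau ^ 2 + Im tau ^ 2)) by (rewrite T; ring).
  unfold geodesic, Re, Im; simpl; ring. }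
unfold Tmap. rewrite Cmod_div.
- unfold Rdiv at 1; rewrite Rpow_mult_distr, pow_inv, E1, E2. field. lra.
- intros E; rewrite E, Cmod_0 in E2. simpl in E2; lra.
Qed.

(** The root in [(-1, 1)] of [a r^2 - (1 + m) r + a]. With [a] the axial coordinate
    of a point and [m] its squared modulus, [r * tau] is the foot of the
    perpendicular geodesic from that point to the diameter. *)
Lemma foot_exists (a m : R) : a ^ 2 <= m -> m < 1 ->
  exists r, -1 < r < 1 /\ a * (1 + r ^ 2) = (1 + m) * r.
Proof.
intros A M.
assert (Ha : 0 <= a ^ 2) by apply pow2_ge_0.
assert (HD : 0 < (1 + m) ^ 2 - 4 * a ^ 2) by nra.
set (s := sqrt ((1 + m) ^ 2 - 4 * a ^ 2)).
assert (Hs : 0 < s) by now apply sqrt_lt_R0.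
assert (Hs2 : s ^ 2 = (1 + m) ^ 2 - 4 * a ^ 2) by (apply pow2_sqrt; lra).
assert (Ha2 : -1 < 2 * a / (1 + m + s) < 1).
{ assert (-(1 + m) < 2 * a < 1 + m) by (split; nra).
  split; apply Rmult_lt_reg_r with (1 + m + s); try lra;
    unfold Rdiv; rewrite Rmult_assoc, Rinv_l; lra. }
exists (2 * a / (1 + m + s)); split; [exact Ha2|].
apply Rmult_eq_reg_r with ((1 + m + s) ^ 2); [|apply pow_nonzero; lra].
replace (a * (1 + (2 * a / (1 + m + s)) ^ 2) * (1 + m + s) ^ 2)
  with (a * ((1 + m) ^ 2 + 2 * (1 + m) * s + s ^ 2 + 4 * a ^ 2)) by (field; lra).
rewrite Hs2. field. lra.
Qed.

(** By [Cmod_Tmap_geodesic], maximal here means closest. *)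
Lemma foot_maximizes (a m r0 r : R) : a ^ 2 <= m -> m < 1 ->
  -1 < r0 < 1 -> a * (1 + r0 ^ 2) = (1 + m) * r0 -> -1 < r < 1 -> r <> r0 ->
  (1 - r ^ 2) / (1 - 2 * a * r + m * r ^ 2) < (1 - r0 ^ 2) / (1 - 2 * a * r0 + m * r0 ^ 2).
Proof.
intros A M Hr0 E Hr Hne.
assert (D := Tmap_denominator_pos a m r A M Hr).
assert (D0 := Tmap_denominator_pos a m r0 A M Hr0).
apply Rmult_lt_reg_r with ((1 - 2 * a * r + m * r ^ 2) * (1 - 2 * a * r0 + m * r0 ^ 2));
  [now apply Rmult_lt_0_compat|].
match goal with |- ?u / ?v * _ < ?u' / ?v' * _ =>
  replace (u / v * (v * v')) with (u * v') by (field; lra);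
  replace (u' / v' * (v * v')) with (u' * v) by (field; lra) end.
(* The difference is a positive multiple of a square. *)
assert (I : (1 - r0 ^ 2) * (1 - 2 * a * r + m * r ^ 2) - (1 - r ^ 2) * (1 - 2 * a * r0 + m * r0 ^ 2)
  = (1 + m - 2 * a * r0) * (r - r0) ^ 2 
    + 2 * (r0 - r) * (a * (1 + r0 ^ 2) - (1 + m) * r0)) by ring.
rewrite E, Rminus_diag, Rmult_0_r, Rplus_0_r in I.
assert (Hm : 0 <= m) by (assert (0 <= a ^ 2) by apply pow2_ge_0; lra).
assert (P1 : 0 < 1 + m - 2 * a * r0).
{ assert (-(1 + m) <= 2 * a <= 1 + m) by (split; nra).
  destruct (Rle_lt_dec 0 r0) as [L|L].
  - assert (0 <= (1 + m - 2 * a) * r0) by (apply Rmult_le_pos; lra). nra.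
  - assert (0 <= (1 + m + 2 * a) * - r0) by (apply Rmult_le_pos; lra). nra. }
assert (P2 : 0 < (r - r0) ^ 2) by (apply pow2_gt_0; lra).
assert (P3 := Rmult_lt_0_compat _ _ P1 P2). lra.
Qed.

Lemma proj_geodesic_foot (tau z : C) (r0 : R) : Cmod tau = 1 -> disc z -> -1 < r0 < 1 ->
  axial tau z * (1 + r0 ^ 2) = (1 + Cmod z ^ 2) * r0 ->
  proj_geodesic tau z = geodesic tau r0.
Proof.
intros Htau Hz Hr0 E.
assert (A := axial_sqr_le tau z Htau).
assert (M := disc_sqr_bounds z Hz).
set (P := fun r => Cmod (Tmap z (geodesic tau r))).
assert (HP1 : forall r, -1 < r < 1 -> P r < 1).
{ intros r Hr; assert (F := Cmod_Tmap_geodesic tau z r Htau Hz Hr). fold (P r) in F.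
  assert (D := Tmap_denominator_pos _ _ r A (proj2 M) Hr).
  assert (G : 0 < (1 - Cmod z ^ 2) * ((1 - r ^ 2) / (1 - 2 * axial tau z * r + Cmod z ^ 2 * r ^ 2))).
  { apply Rmult_lt_0_compat; [lra|apply Rdiv_lt_0_compat; [nra|exact D]]. }
  assert (0 <= P r) by apply Cmod_ge_0. nra. }
assert (HP2 : forall r, -1 < r < 1 -> r <> r0 -> P r0 < P r).
{ intros r Hr Hne; assert (F := Cmod_Tmap_geodesic tau z r Htau Hz Hr).
  assert (F0 := Cmod_Tmap_geodesic tau z r0 Htau Hz Hr0). fold (P r) in F. fold (P r0) in F0.
  assert (G := foot_maximizes _ _ r0 r A (proj2 M) Hr0 E Hr Hne).
  apply Rmult_lt_compat_l with (r := 1 - Cmod z ^ 2) in G; [|lra].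
  assert (0 <= P r) by apply Cmod_ge_0. assert (0 <= P r0) by apply Cmod_ge_0. nra. }
assert (Hom : forall r, -1 < r < 1 -> r <> r0 ->
  omega z (geodesic tau r0) < omega z (geodesic tau r)).
{ intros r Hr Hne. apply (hyp_lt (P r0) (P r)); [apply Cmod_ge_0|now apply HP2|now apply HP1]. }
assert (Hclosest : closest_on_geodesic tau z (geodesic tau r0)).
{ split; [now exists r0|].
  intros r Hr; destruct (Req_dec r r0) as [->|Hne]; [apply Rle_refl|now apply Rlt_le, Hom]. }
assert (Huniq : forall p, closest_on_geodesic tau z p -> p = geodesic tau r0).
{ intros p [[r [Hr ->]] Hmin]. destruct (Req_dec r r0) as [->|Hne]; [reflexivity|exfalso].
  assert (B := Hmin r0 Hr0). assert (B' := Hom r Hr Hne). lra. }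
apply Huniq. unfold proj_geodesic.
apply (iota_correct (V := C_CompleteNormedModule)).
exists (geodesic tau r0); split; [exact Hclosest|].
intros p Hp; symmetry; now apply Huniq.
Qed.

(** The bound [v^o <= v], with [r] the foot of the perpendicular. *)
Lemma hyp_foot_le (x a r : R) : 0 <= x < 1 -> a ^ 2 <= x ^ 2 -> -1 < r < 1 ->
  a * (1 + r ^ 2) = (1 + x ^ 2) * r -> hyp (Rabs r) <= hyp x.
Proof.
intros Hx Ha Hr E.
assert (Hr' : 0 <= Rabs r < 1) by (split; [apply Rabs_pos|now apply Rabs_lt_between]).
assert (Hr2 : Rabs r ^ 2 = r ^ 2) by now rewrite pow2_abs.
assert (Ha' : Rabs a <= x) by (apply Rabs_le; split; nra).
assert (E' : Rabs a * (1 + Rabs r ^ 2) = (1 + x ^ 2) * Rabs r).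
{ rewrite Hr2, <- (Rabs_pos_eq (1 + r ^ 2)), <- (Rabs_pos_eq (1 + x ^ 2)) by nra.
  rewrite <- !Rabs_mult. now rewrite E. }
apply hyp_le; try lra.
(* The assumptions say that [(|r| - x) (1 - |r| x) <= 0]. *)
assert (H1 : (1 + x ^ 2) * Rabs r <= x * (1 + Rabs r ^ 2)).
{ rewrite <- E'. apply Rmult_le_compat_r; [nra|exact Ha']. }
assert (H2 : 0 < 1 - Rabs r * x) by nra.
destruct (Rle_lt_dec (Rabs r) x) as [L|L]; [exact L|exfalso]. nra.
Qed.

(** The bound [v <= 2 v^o + (ln 2) / 2]; the hypothesis [x^2 <= a] is Julia's
    inequality. *)
Lemma hyp_le_twice_foot (x a r : R) : 0 <= x < 1 -> x ^ 2 <= a -> -1 < r < 1 ->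
  a * (1 + r ^ 2) = (1 + x ^ 2) * r -> hyp x <= 2 * hyp (Rabs r) + / 2 * ln 2.
Proof.
intros Hx Ha Hr E.
assert (Hx2 : 0 <= x ^ 2) by apply pow2_ge_0.
assert (Hr2 : 0 <= r ^ 2) by apply pow2_ge_0.
assert (Hr0 : 0 <= r).
{ apply Rmult_le_reg_l with (1 + x ^ 2); [lra|]. rewrite Rmult_0_r, <- E.
  apply Rmult_le_pos; lra. }
rewrite (Rabs_pos_eq r) by exact Hr0.
unfold hyp.
set (B := (1 + r) / (1 - r)).
assert (HB : 0 < B) by (apply Rdiv_lt_0_compat; lra).
replace (2 * (/ 2 * ln B) + / 2 * ln 2) with (/ 2 * ln (2 * (B * B)))
  by (rewrite (ln_mult 2 (B * B)), (ln_mult B B) by first [lra|exact (Rmult_lt_0_compat _ _ HB HB)]; field).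
apply Rmult_le_compat_l; [lra|].
apply ln_le; [apply Rdiv_lt_0_compat; lra|].
assert (Hma : x ^ 2 * (1 + r ^ 2) <= (1 + x ^ 2) * r).
{ rewrite <- E. apply Rmult_le_compat_r; lra. }
assert (H1 : (1 + x ^ 2) * (1 - r) ^ 2 <= (1 - x ^ 2) * (1 + r ^ 2)) by nra.
assert (H2 : (1 + 3 * x ^ 2) * (1 + r ^ 2) <= (1 + x ^ 2) * (1 + r) ^ 2) by nra.
assert (H3 : (1 + x) * (1 - r) ^ 2 <= 2 * (1 - x) * (1 + r) ^ 2).
{ apply Rmult_le_reg_l with (1 + x ^ 2); [lra|].
  apply Rle_trans with ((1 + x) * ((1 - x ^ 2) * (1 + r ^ 2))).
  { replace ((1 + x ^ 2) * ((1 + x) * (1 - r) ^ 2))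
      with ((1 + x) * ((1 + x ^ 2) * (1 - r) ^ 2)) by ring.
    apply Rmult_le_compat_l; lra. }
  apply Rle_trans with (2 * (1 - x) * ((1 + 3 * x ^ 2) * (1 + r ^ 2))).
  { replace ((1 + x) * ((1 - x ^ 2) * (1 + r ^ 2)))
      with ((1 - x) * (1 + r ^ 2) * (1 + x) ^ 2) by ring.
    replace (2 * (1 - x) * ((1 + 3 * x ^ 2) * (1 + r ^ 2)))
      with ((1 - x) * (1 + r ^ 2) * (2 * (1 + 3 * x ^ 2))) by ring.
    apply Rmult_le_compat_l; [apply Rmult_le_pos; lra|nra]. }
  replace ((1 + x ^ 2) * (2 * (1 - x) * (1 + r) ^ 2))
    with (2 * (1 - x) * ((1 + x ^ 2) * (1 + r) ^ 2)) by ring.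
  apply Rmult_le_compat_l; lra. }
apply Rmult_le_reg_r with ((1 - x) * (1 - r) ^ 2).
{ apply Rmult_lt_0_compat; [lra|apply pow_lt; lra]. }
unfold B.
replace ((1 + x) / (1 - x) * ((1 - x) * (1 - r) ^ 2)) with ((1 + x) * (1 - r) ^ 2) by (field; lra).
replace (2 * ((1 + r) / (1 - r) * ((1 + r) / (1 - r))) * ((1 - x) * (1 - r) ^ 2))
  with (2 * (1 - x) * (1 + r) ^ 2) by (field; lra).
exact H3.
Qed.

(** * The speeds of a non-elliptic semigroup *)

Theorem mainTheorem3 :
  exists C1 C2 : R,
    forall (phi : R -> C -> C) (tau : C),
      nonelliptic_semigroup phi ->
      Denjoy_Wolff_point phi tau ->
      forall t : R, 0 <= t ->
        orthogonal_speed phi tau t + C1 <= total_speed phi t /\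
        total_speed phi t <= 2 * orthogonal_speed phi tau t + C2.
Proof.
exists 0, (/ 2 * ln 2); intros phi tau Hsg HDW t Ht.
assert (Htau : Cmod tau = 1) by apply HDW.
assert (H0 : disc 0) by (unfold disc; rewrite Cmod_0; lra).
assert (Hz : disc (phi t 0)) by now apply (sg_holomorphic _ Hsg t Ht).
assert (HJ := Julia phi tau Hsg HDW t Ht).
unfold total_speed, orthogonal_speed.
set (z := phi t 0) in *.
assert (A := axial_sqr_le tau z Htau).
destruct (foot_exists _ _ A (proj2 (disc_sqr_bounds z Hz))) as [r [Hr E]].
rewrite (proj_geodesic_foot tau z r Htau Hz Hr E), !omega_0.
unfold geodesic; rewrite Cmod_mult, Htau, Rmult_1_r, Cmod_R, Rplus_0_r.
assert (Hx : 0 <= Cmod z < 1) by (split; [apply Cmod_ge_0|exact Hz]).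
split.
- now apply hyp_foot_le with (axial tau z).
- apply hyp_le_twice_foot with (axial tau z); try assumption.
  assert (T := unit_sqr tau Htau). rewrite !Cmod2_alt in HJ. rewrite Cmod2_alt.
  unfold axial. unfold Re, Im in *; simpl in HJ. simpl in T. simpl. lra.
Qed.
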